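(* Let $G = \langle A * B;\ H\rangle$ be the generalized free product of groups $A$ and $B$ with amalgamated subgroup $H$, and let $\mathfrak{P}$ be a non-empty set of primes. Suppose that the subgroups $1$ and $H$ are $\mathcal{FN}_{\mathfrak{P}}$-separable in each of the free factors $A$, $B$ and, for any $p \in \mathfrak{P}$, $G$ is $\mathcal{F}_{p}$-quasi-regular with respect to $H$. Then the following statements hold. 1. The group $G$ is residually a $\Phi\cdot\mathcal{FN}_{\mathfrak{P}}$-group and, for each prime $p$, residually an $\mathcal{F}_{p}\cdot\mathcal{FN}_{\mathfrak{P}}$-group. 2. If, for some $q \in \mathfrak{P}$, the set $U = q'\text{-}\mathfrak{Rt}(H,1)$ is a subgroup which is $\mathcal{F}_{q}$-separable in $H$, and $H$ is $\mathcal{F}_{q}$-separable in each of the free factors $A$, $B$, then $G$ is residually an $\mathcal{FN}_{\mathfrak{P}}$-group.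
   Context: $G=\langle A*B;\ H\rangle$ means that $G$ is the generalized (amalgamated) free product of $A$ and $B$ with amalgamated subgroup $H$; $A$ and $B$ are regarded as subgroups of $G$, with $A\cap B=H$. For a set of primes $\mathfrak{P}$, a $\mathfrak{P}$-group is a periodic group in which all prime divisors of orders of elements lie in $\mathfrak{P}$. $\Phi$, $\mathcal{FN}_{\mathfrak{P}}$, $\mathcal{F}_p$ are the classes of free groups, finite nilpotent $\mathfrak{P}$-groups and finite $p$-groups. For classes $\mathcal{C},\mathcal{D}$, $\mathcal{C}\cdot\mathcal{D}$ is the class of all extensions of a $\mathcal{C}$-group by a $\mathcal{D}$-group (groups having a normal subgroup in $\mathcal{C}$ with quotient in $\mathcal{D}$). A group $X$ is residually a $\mathcal{C}$-group if for every $x\in X\setminus\{1\}$ there is a homomorphism $\sigma$ of $X$ onto a group from $\mathcal{C}$ with $x\sigma\neq1$. A subgroup $Y\leqslant X$ is $\mathcal{C}$-separable in $X$ if for every $x\in X\setminus Y$ there is a homomorphism $\sigma$ of $X$ onto a group from $\mathcal{C}$ with $x\sigma\notin Y\sigma$. $\mathcal{C}^{*}(X)$ is the family of normal subgroups $Y$ of $X$ with $X/Y\in\mathcal{C}$. $X$ is $\mathcal{C}$-quasi-regular with respect to a subgroup $Y$ if for every $M\in\mathcal{C}^{*}(Y)$ there is $N\in\mathcal{C}^{*}(X)$ with $N\cap Y\leqslant M$. For a prime $q$, a $q'$-number is an integer not divisible by $q$, and $q'\text{-}\mathfrak{Rt}(X,1)$ is the set of $x\in X$ with $x^n=1$ for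 some (positive) $q'$-number $n$. *)

(* Defs.v *)
From HB Require Import structures.
From mathcomp Require Import all_boot all_fingroup all_solvable.
From mathcomp Require Import generic_quotient boolp.

Set Implicit Arguments.
Unset Strict Implicit.
Unset Printing Implicit Defensive.

Import Algebra.

Local Open Scope group_scope.
Local Open Scope quotient_scope.

(* A group is an arbitrary, possibly infinite, [groupType].  Subsets are boolean
   predicates (no restriction, classically) and subgroups of [G] are the
   elements of [groupClosed G]. *)

Section SubgroupAsGroup.
Variables (G : groupType) (S : groupClosed G).

Definition subgroup_type : Type := {x : G | x \in S}.

Lemma groupClosed_closed : group_closed S.
Proof. by split; [exact: gpred1 | exact: gpredF]. Qed.

HB.instance Definition _ := SubChoice.on subgroup_type.
HB.instance Definition _ :=
  SubChoice_isSubGroup.Build G (fun x => x \in S) subgroup_type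
    groupClosed_closed.

End SubgroupAsGroup.

Record normalSubgroup (G : groupType) := NormalSubgroup {
  nsubgroup :> groupClosed G;
  nsubgroupJ : forall x y : G, x \in nsubgroup -> x ^ y \in nsubgroup
}.

Section QuotientGroup.
Variables (G : groupType) (N : normalSubgroup G).

Definition coset_eq (x y : G) : bool := x^-1 * y \in (N : groupClosed G).

Lemma coset_eq_refl : reflexive coset_eq.
Proof. by move=> x; rewrite /coset_eq mulVg gpred1. Qed.

Lemma coset_eq_sym : symmetric coset_eq.
Proof.
by move=> x y; rewrite /coset_eq -[RHS]gpredV invgM invgK.
Qed.

Lemma coset_eq_trans : transitive coset_eq.
Proof.
move=> y x z xy yz; rewrite /coset_eq.
have -> : x^-1 * z = (x^-1 * y) * (y^-1 * z) by rewrite mulgA mulgK.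
exact: gpredM.
Qed.

Canonical coset_equiv :=
  EquivRel coset_eq coset_eq_refl coset_eq_sym coset_eq_trans.

Definition quotient_type : Type := {eq_quot coset_eq}.

HB.instance Definition _ := Choice.on quotient_type.
HB.instance Definition _ := EqQuotient.on quotient_type.

(* the canonical projection of [G] onto [G / N] *)
Definition coset_proj (x : G) : quotient_type := \pi_quotient_type x.

Lemma coset_projW (Q : quotient_type -> Prop) :
  (forall x, Q (coset_proj x)) -> forall u, Q u.
Proof. by move=> Qp u; rewrite -[u]reprK; exact: Qp. Qed.

Definition quotient_one : quotient_type := coset_proj 1.
Definition quotient_mul (u v : quotient_type) : quotient_type :=
  coset_proj (repr u * repr v).
Definition quotient_inv (u : quotient_type) : quotient_type :=
  coset_proj (repr u)^-1.

Lemma coset_projE (x y : G) :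
  (coset_proj x = coset_proj y) <-> coset_eq x y.
Proof. by split=> [/eqP|xy]; [|apply/eqP]; rewrite piE. Qed.

Lemma coset_proj_repr (x : G) : coset_eq x (repr (coset_proj x)).
Proof. by apply/coset_projE; rewrite /coset_proj reprK. Qed.

Lemma coset_projM (x y : G) :
  quotient_mul (coset_proj x) (coset_proj y) = coset_proj (x * y).
Proof.
apply/esym/coset_projE; rewrite /coset_eq.
set x' := repr _; set y' := repr _.
have xx' : coset_eq x x' := coset_proj_repr x.
have yy' : coset_eq y y' := coset_proj_repr y.
have -> : (x * y)^-1 * (x' * y') = (x^-1 * x') ^ y * (y^-1 * y').
  by rewrite /conjg invgM !mulgA mulgK.
by apply: gpredM => //; apply: nsubgroupJ.
Qed.

Lemma coset_projV (x : G) : quotient_inv (coset_proj x) = coset_proj x^-1.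
Proof.
apply/coset_projE; rewrite /coset_eq invgK; set x' := repr _.
have xx' : coset_eq x x' := coset_proj_repr x.
have -> : x' * x^-1 = (x^-1 * x') ^ x^-1.
  by rewrite /conjg invgK !mulgA mulgV mul1g.
exact: nsubgroupJ.
Qed.

Lemma quotient_mulA : associative quotient_mul.
Proof.
elim/coset_projW=> x; elim/coset_projW=> y; elim/coset_projW=> z.
by rewrite !coset_projM mulgA.
Qed.

Lemma quotient_mul1 : left_id quotient_one quotient_mul.
Proof. by elim/coset_projW=> x; rewrite coset_projM mul1g. Qed.

Lemma quotient_1mul : right_id quotient_one quotient_mul.
Proof. by elim/coset_projW=> x; rewrite coset_projM mulg1. Qed.

Lemma quotient_mulV : left_inverse quotient_one quotient_inv quotient_mul.
Proof. by elim/coset_projW=> x; rewrite coset_projV coset_projM mulVg. Qed.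

Lemma quotient_Vmul : right_inverse quotient_one quotient_inv quotient_mul.
Proof. by elim/coset_projW=> x; rewrite coset_projV coset_projM mulgV. Qed.

HB.instance Definition _ := isGroup.Build quotient_type
  quotient_mulA quotient_mul1 quotient_1mul quotient_mulV quotient_Vmul.

End QuotientGroup.

Definition group_class := groupType -> Prop.

Definition surjective (X Y : Type) (f : X -> Y) : Prop :=
  forall y, exists x, f x = y.

Definition has_order (G : groupType) (x : G) (n : nat) : Prop :=
  [/\ (0 < n)%N, x ^+ n = 1 & forall m, (0 < m < n)%N -> x ^+ m != 1].

(* periodic, with all prime divisors of orders of elements in [P] *)
Definition periodic_pgroup (P : nat_pred) : group_class := fun G =>
  forall x : G, exists2 n, has_order x n & P.-nat n.

Definition isomorphic (G K : groupType) : Prop :=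
  exists f : {multiplicative G -> K}, bijective f.

Definition finite_group : group_class := fun G =>
  exists F : finGroupType, isomorphic G F.

Definition finite_nilpotent : group_class := fun G =>
  exists2 F : finGroupType, isomorphic G F & nilpotent [set: F].

Definition FN (P : nat_pred) : group_class := fun G =>
  finite_nilpotent G /\ periodic_pgroup P G.

(* [p] is coerced to the singleton predicate [pred1 p] *)
Definition Fp (p : nat) : group_class := fun G =>
  finite_group G /\ periodic_pgroup p G.

(* free on some subset [S], by the universal property; the values of [f]
   outside [S] are irrelevant *)
Definition is_free : group_class := fun G =>
  exists S : {pred G}, forall (K : groupType) (f : G -> K),
    exists2 phi : {multiplicative G -> K}, {in S, phi =1 f} &
      forall psi : {multiplicative G -> K}, {in S, psi =1 f} -> psi =1 phi.

Definition extension (C D : group_class) : group_class := fun G =>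
  exists N : normalSubgroup G, C (subgroup_type N) /\ D (quotient_type N).

Definition residually (C : group_class) (G : groupType) : Prop :=
  forall x : G, x != 1 ->
    exists (Q : groupType) (f : {multiplicative G -> Q}),
      [/\ surjective f, C Q & f x != 1].

Definition is_separable (C : group_class) (G : groupType) (Y : {pred G}) : Prop :=
  forall x : G, x \notin Y ->
    exists (Q : groupType) (f : {multiplicative G -> Q}),
      [/\ surjective f, C Q & ~ exists2 y, y \in Y & f x = f y].

Definition quasi_regular (C : group_class) (G : groupType) (Y : groupClosed G) :
    Prop :=
  forall M : normalSubgroup (subgroup_type Y), C (quotient_type M) ->
    exists2 N : normalSubgroup G, C (quotient_type N) &
      forall y : subgroup_type Y, val y \in (N : groupClosed G) ->
        y \in (M : groupClosed (subgroup_type Y)).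

(* The elements [x] such that [x ^+ n = 1] for some [n] prime to [q]; such an
   [n] is automatically positive, as [q] divides 0. *)
Definition coprime_roots (q : nat) (G : groupType) : {pred G} :=
  fun x => `[< exists2 n, ~~ (q %| n)%N & x ^+ n = 1 >].
Arguments coprime_roots q G _ : clear implicits.

(* The subgroup [H] of [G], intersected with the subgroup [A] and seen as a
   subset of the group [A]. *)
Definition subset_in (G : groupType) (H A : groupClosed G) :
    {pred subgroup_type A} :=
  fun a => val a \in H.
Arguments subset_in {G} H A _.

(* [G] is the free product of its subgroups [A] and [B] amalgamated along their
   intersection [H], i.e. the pushout of the inclusions of [H] into [A] and
   [B].  The two factors are embedded in [G] and meet exactly in [H]. *)
Definition amalgamated_product (G : groupType) (A B H : groupClosed G) : Prop :=
  (forall x, (x \in H) = (x \in A) && (x \in B)) /\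
  forall (K : groupType)
      (f : {multiplicative subgroup_type A -> K})
      (g : {multiplicative subgroup_type B -> K}),
    (forall (a : subgroup_type A) (b : subgroup_type B),
       val a = val b -> val a \in H -> f a = g b) ->
    exists2 phi : {multiplicative G -> K},
      (forall a, phi (val a) = f a) /\ (forall b, phi (val b) = g b) &
      forall psi : {multiplicative G -> K},
        (forall a, psi (val a) = f a) -> (forall b, psi (val b) = g b) ->
        psi =1 phi.

(* Main.v *)
Require Import Defs.
From HB Require Import structures.
From mathcomp Require Import all_boot all_algebra generic_quotient.
From mathcomp Require Import all_fingroup all_solvable.
From mathcomp Require Import boolp.

(** Both statements come from homomorphisms of [G] to wreath products.  Let
    [nu : G -> Q] be a homomorphism to a finite group.  If [r : A -> K] is a
    homomorphism and [t : Q -> K] a function with [t (u * nu h) = t u * r h]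
    for [h] in [H], then the conjugate by [t] of [a |-> (r a, nu a)] agrees on
    [H] with [b |-> (1, nu b)], hence the two extend to a homomorphism
    from [G] to [K wr Q] ([twisted_wreath_hom]).  It is used twice.

    - Let [r] be a map of [A] to a finite [p]-group.  Quasi-regularity of [G]
      with respect to [H] gives a [nu] to a finite [p]-group such that [nu]
      restricted to [H] has its kernel inside that of [r], which is what the
      construction of [t] requires.  The wreath product is a [p]-group, so
      finite [p]-quotients of the factors are controlled by finite
      [p]-quotients of [G] ([quasi_regular_factor]).  As separation in a finite
      nilpotent group can be checked on one Sylow subgroup at a time
      ([nilpotent_separation]), every separation property of [A] and [B] with
      respect to finite nilpotent groups passes to [G] ([factor_detection]).

    - Let [x] lie outside [B], written as an alternating product
      [b0 a1 b1 .. an bn].  The previous point yields a map [nu] to a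
      finite nilpotent group under which no syllable outside [H] enters the
      image of [H].  For [r = 1] and [t] constant on the left cosets of [nu H],
      the value at [x] is a product of [n] factors [t c / t c'] in which
      consecutive cosets differ, that is, a reduced word in the values of [t].
      By the argument of Magnus for residual properties of free groups, [t] can
      be chosen in unitriangular matrices modulo any prime [p] so that this
      product is not 1 ([magnus_separation], [word_detection]).  The image of
      [G] is then an extension of a finite [p]-group by a finite nilpotent
      group, in which [x] survives.  If [Q] is a [q]-group and [p = q], the
      image is a [q]-group; this gives the last statement.

    For the free-by-nilpotent quotient, divide [G] by the normal closure [L] of
    the elements of [A] and [B] killed by [nu].  The wreath products above
    factor through [G / L], so [x] survives there; and [G / L] is again an
    amalgamated product ([amalgamated_quotient]), on whose factors the map
    induced by [nu] is injective.  The kernel of that map acts freely on the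
    Bass-Serre tree and is therefore free.  Instead of the tree, [free_kernel]
    uses two compatible Schreier transversals, one for each factor; the
    universal property of the free generators is again supplied by a
    homomorphism to a wreath product. *)

Set Implicit Arguments.
Unset Strict Implicit.
Unset Printing Implicit Defensive.

Import Algebra.

Local Open Scope group_scope.

(** * Homomorphisms, quotients and kernels *)

Section Build.
Variables (G K : groupType).

Definition hom_of (f : G -> K) (fM : {morph f : x y / x * y}) :
    {multiplicative G -> K} :=
  HB.pack_for {multiplicative G -> K} f (isMultiplicative.Build G K f fM).

Definition closed_of (S : {pred G}) (Scl : group_closed S) : groupClosed G :=
  HB.pack_for (groupClosed G) S
    (isMulClosed.Build G S (group_closedM Scl))
    (isMul1Closed.Build G S Scl.1)
    (isInvClosed.Build G S (group_closedV Scl)).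

Lemma closed_ofE (S : {pred G}) (Scl : group_closed S) x :
  (x \in closed_of Scl) = (x \in S).
Proof. by []. Qed.

End Build.

Section HomTheory.
Variables (G K : groupType) (f : {multiplicative G -> K}).

Lemma hom1 : f 1 = 1.
Proof. by apply: (mulgI (f 1)); rewrite -gmulfM !mulg1. Qed.

Definition umagma_hom : UMagmaMorphism.type G K :=
  HB.pack_for (UMagmaMorphism.type G K) (f : G -> K)
    (isMultiplicative.Build G K f (@gmulfM _ _ f))
    (Multiplicative_isUMagmaMorphism.Build G K f hom1).

Lemma homV : {morph f : x / x^-1}. Proof. exact: (gmulfV umagma_hom). Qed.

Lemma homF : {morph f : x y / x * y^-1}. Proof. exact: (gmulfF umagma_hom). Qed.

Lemma homX n : {morph f : x / x ^+ n}. Proof. exact: (gmulfXn umagma_hom). Qed.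

Lemma homJ (x y : G) : f (x ^ y) = f x ^ f y.
Proof. exact: (gmulfJ umagma_hom). Qed.

Lemma hom_inj : (forall x, f x = 1 -> x = 1) -> injective f.
Proof. exact: (gmulf_inj (f := umagma_hom)). Qed.

Lemma hom_eq1 x : injective f -> (f x == 1) = (x == 1).
Proof. exact: (gmulf_eq1 (f := umagma_hom)). Qed.

End HomTheory.

Section Quotient.
Variables (G : groupType) (N : normalSubgroup G).

Lemma projM : {morph @coset_proj G N : x y / x * y}.
Proof. by move=> x y; rewrite -coset_projM. Qed.

Definition proj : {multiplicative G -> quotient_type N} := hom_of projM.

Lemma proj_surj : surjective proj.
Proof. by elim/coset_projW=> x; exists x. Qed.

Lemma proj_eq1 x : (proj x = 1) <-> x \in (N : groupClosed G).
Proof.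
split=> [/esym/coset_projE|xN]; first by rewrite /coset_eq invg1 mul1g.
by apply/esym/coset_projE; rewrite /coset_eq invg1 mul1g.
Qed.

Section Lift.
Variables (K : groupType) (f : {multiplicative G -> K}).
Hypothesis fN : forall x, x \in (N : groupClosed G) -> f x = 1.

Definition quotient_lift_fun (u : quotient_type N) : K :=
  f (generic_quotient.repr u).

Lemma quotient_lift_funE x : quotient_lift_fun (coset_proj N x) = f x.
Proof.
have := coset_proj_repr N x; rewrite /coset_eq => /fN.
by rewrite gmulfM homV => /mulg1_eq; rewrite invgK.
Qed.

Lemma quotient_lift_funM : {morph quotient_lift_fun : u v / u * v}.
Proof.
elim/coset_projW=> x; elim/coset_projW=> y.
by rewrite -projM !quotient_lift_funE gmulfM.
Qed.

Definition quotient_lift : {multiplicative quotient_type N -> K} :=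
  hom_of quotient_lift_funM.

Lemma quotient_liftE x : quotient_lift (proj x) = f x.
Proof. exact: quotient_lift_funE. Qed.

End Lift.
End Quotient.

Section Kernel.
Variables (G K : groupType) (f : {multiplicative G -> K}).

Definition kernel_pred : {pred G} := fun x => f x == 1.

Lemma kernel_closed : group_closed kernel_pred.
Proof.
split=> [|x y]; rewrite /kernel_pred !unfold_in; first by rewrite hom1.
by move=> /eqP fx /eqP fy; rewrite homF fx fy divg1.
Qed.

Lemma kernelJ x y :
  x \in closed_of kernel_closed -> x ^ y \in closed_of kernel_closed.
Proof.
rewrite !closed_ofE !unfold_in => /eqP fx.
by rewrite homJ fx conj1g.
Qed.

Definition kernel : normalSubgroup G := NormalSubgroup kernelJ.

Lemma kernelP x : reflect (f x = 1) (x \in (kernel : groupClosed G)).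
Proof. exact: eqP. Qed.

(** The embedding of [G / ker f] through which a class of finite groups is
    recognised from a homomorphism to a single finite group. *)
Lemma kernel_lift_inj :
  injective (quotient_lift (N := kernel) (fun x => elimT (kernelP x))).
Proof.
apply: hom_inj; elim/coset_projW=> x; rewrite (quotient_liftE _ x) => /kernelP.
by move/proj_eq1.
Qed.

End Kernel.

(** * Finite quotients *)

Lemma order_has_order (F : finGroupType) (x : F) : has_order x #[x].
Proof.
split=> [||m /andP[m_gt0 m_lt]]; [exact: order_gt0 | exact: expg_order |].
rewrite -order_dvdn; apply: contraL m_lt => /(dvdn_leq m_gt0).
by rewrite leqNgt.
Qed.

Lemma has_order_inj (G K : groupType) (f : {multiplicative G -> K}) :
  injective f -> forall x n, has_order (f x) n <-> has_order x n.
Proof.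
move=> f_inj x n.
have fX m : (f x ^+ m == 1) = (x ^+ m == 1) by rewrite -homX hom_eq1.
split=> -[n_gt0 /eqP fxn min]; split=> //.
- by apply/eqP; rewrite -fX.
- by move=> m /min; rewrite fX.
- by apply/eqP; rewrite fX.
- by move=> m /min; rewrite fX.
Qed.

Lemma has_order_uniq (G : groupType) (x : G) m n :
  has_order x m -> has_order x n -> m = n.
Proof.
move=> [m0 xm minm] [n0 xn minn].
case: (ltngtP m n) => // [ltmn|ltnm].
- by have := minn m; rewrite m0 ltmn xm eqxx => /(_ isT).
- by have := minm n; rewrite n0 ltnm xn eqxx => /(_ isT).
Qed.

Lemma pgroup_orders (F : finGroupType) (P : nat_pred) :
  P.-group [set: F] <-> periodic_pgroup P F.
Proof.
split=> [PF x|PF].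
  exists #[x]; first exact: order_has_order.
  by apply: mem_p_elt PF _; rewrite inE.
apply/pgroupP=> p p_pr /(Cauchy p_pr) [x _ ox].
have [n xn] := PF x; rewrite (has_order_uniq xn (order_has_order x)) ox.
by rewrite pnatE.
Qed.

Lemma periodic_inj (P : nat_pred) (G K : groupType)
    (f : {multiplicative G -> K}) :
  injective f -> periodic_pgroup P K -> periodic_pgroup P G.
Proof.
move=> f_inj PK x; have [n xn Pn] := PK (f x).
by exists n => //; apply/(has_order_inj f_inj).
Qed.

Definition nil_pgroup (P : nat_pred) (F : finGroupType) :=
  nilpotent [set: F] /\ P.-group [set: F].

Section Embed.
Variables (G : groupType) (F : finGroupType) (f : {multiplicative G -> F}).

Definition hom_image : {set F} := [set y | `[< exists x, f x = y >]].

Lemma hom_imageP y : reflect (exists x, f x = y) (y \in hom_image).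
Proof. by rewrite inE; exact: asboolP. Qed.

Lemma mem_hom_image x : f x \in hom_image.
Proof. by apply/hom_imageP; exists x. Qed.

Lemma group_set_hom_image : group_set hom_image.
Proof.
apply/group_setP; split; first by apply/hom_imageP; exists 1; rewrite hom1.
move=> _ _ /hom_imageP[x <-] /hom_imageP[y <-].
by rewrite -gmulfM mem_hom_image.
Qed.

Canonical hom_image_group := Group group_set_hom_image.

Definition corestr_fun (x : G) : subg_of hom_image_group :=
  subg hom_image_group (f x).

Lemma corestrM : {morph corestr_fun : x y / x * y}.
Proof.
move=> x y; apply: val_inj => /=.
by rewrite /corestr_fun gmulfM /= !subgK ?groupM ?mem_hom_image.
Qed.

Definition corestr : {multiplicative G -> subg_of hom_image_group} :=
  hom_of corestrM.

Lemma sgval_corestr x : sgval (corestr x) = f x.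
Proof. by rewrite /= /corestr_fun subgK ?mem_hom_image. Qed.

Lemma corestr_surj : surjective corestr.
Proof.
case=> y yI; have /hom_imageP[x fx] := yI.
by exists x; apply: val_inj; rewrite /= -[LHS]/(sgval _) sgval_corestr.
Qed.

Lemma corestr_bij : injective f -> bijective corestr.
Proof.
move=> f_inj; have [g gK] := choice corestr_surj.
by exists g => // x; apply: f_inj; rewrite -2!sgval_corestr gK.
Qed.

Lemma card_subg_image : #|[set: subg_of hom_image_group]| = #|hom_image|.
Proof. by rewrite -(card_isog (isog_subg hom_image_group)). Qed.

Lemma nilpotent_corestr :
  nilpotent [set: F] -> nilpotent [set: subg_of hom_image_group].
Proof.
move=> nF; rewrite -(isog_nil (isog_subg hom_image_group)).
by rewrite (nilpotentS _ nF) ?subsetT.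
Qed.

Lemma nil_pgroup_corestr (P : nat_pred) :
  nil_pgroup P F -> nil_pgroup P (subg_of hom_image_group).
Proof.
move=> [nF PF]; split; first exact: nilpotent_corestr.
by rewrite /pgroup card_subg_image; apply: pgroupS PF; exact: subsetT.
Qed.

End Embed.

Lemma FN_embed (P : nat_pred) (G : groupType) (F : finGroupType)
    (f : {multiplicative G -> F}) :
  injective f -> nil_pgroup P F -> FN P G.
Proof.
move=> f_inj [nF PF].
split; last exact: periodic_inj f_inj ((pgroup_orders _ _).1 PF).
exists (subg_of (hom_image_group f)); last exact: nilpotent_corestr.
by exists (corestr f); exact: corestr_bij.
Qed.

Lemma FN_inv (P : nat_pred) (G : groupType) : FN P G ->
  exists (F : finGroupType) (f : {multiplicative G -> F}),
    injective f /\ nil_pgroup P F.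
Proof.
case=> -[F [f [g fK gK]] nF] PG; exists F, f; split; first exact: can_inj fK.
split=> //; apply/pgroup_orders.
have gM : {morph g : x y / x * y} by apply: (can2_gmulfM fK gK).
exact: (@periodic_inj _ _ _ (hom_of gM) (can_inj gK) PG).
Qed.

Lemma Fp_embed (p : nat) (G : groupType) (F : finGroupType)
    (f : {multiplicative G -> F}) :
  injective f -> periodic_pgroup p G -> Fp p G.
Proof.
move=> f_inj PG; split => //.
exists (subg_of (hom_image_group f)).
by exists (corestr f); exact: corestr_bij.
Qed.

Lemma Fp_inv (p : nat) (G : groupType) : Fp p G ->
  exists (F : finGroupType) (f : {multiplicative G -> F}),
    injective f /\ p.-group [set: F].
Proof.
case=> -[F [f [g fK gK]]] PG; exists F, f; split; first exact: can_inj fK.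
apply/pgroup_orders.
have gM : {morph g : x y / x * y} by apply: (can2_gmulfM fK gK).
exact: (@periodic_inj _ _ _ (hom_of gM) (can_inj gK) PG).
Qed.

(** * Separation by a single prime *)

Lemma pgroup_nil_pgroup (p : nat) (P : nat_pred) (F : finGroupType) :
  p \in P -> p.-group [set: F] -> nil_pgroup P F.
Proof.
move=> pP pF; split; first exact: pgroup_nil pF.
by apply: sub_pgroup pF => r /eqP ->.
Qed.

Lemma trivial_nil_pgroup (P : nat_pred) :
  exists F : finGroupType, nil_pgroup P F.
Proof.
exists (subg_of (1%G : {group 'S_1})); split.
  by rewrite -(isog_nil (isog_subg 1%G)) nilpotent1.
by rewrite /pgroup -(card_isog (isog_subg 1%G)) cards1.
Qed.

Lemma nil_pgroup_prod (P : nat_pred) (E F : finGroupType) :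
  nil_pgroup P E -> nil_pgroup P F -> nil_pgroup P (E * F)%type.
Proof.
move=> [nE PE] [nF PF].
have dEF := setX_dprod [set: E] [set: F].
rewrite /nil_pgroup (_ : [set: (E * F)%type] = setX [set: E] [set: F]);
  last by apply/setP=> x; rewrite !inE.
split.
  rewrite (dprod_nil dEF) -(morphim_pairg1 _ [set: E]).
  rewrite -(morphim_pair1g _ [set: F]) !injm_nil ?subsetT ?injm_pairg1 //.
    by rewrite nE nF.
  exact: injm_pair1g.
by rewrite /pgroup cardsX pnatM; apply/andP.
Qed.

(** A nilpotent group is the direct product of its Sylow subgroups, and so is
    each of its subgroups [D].  If [z] is not in [D], then some [p]-constituent
    of [z] is not in [D], and the quotient by the [p']-core, which is a copy of
    the Sylow [p]-subgroup, still separates [z] from [D]. *)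
Lemma nilpotent_separation (P : nat_pred) (F : finGroupType) (D : {group F})
    (z : F) :
  nil_pgroup P F -> z \notin D ->
  exists2 p, p \in P & exists (E : finGroupType) (f : {multiplicative F -> E}),
    p.-group [set: E] /\ f z \notin f @: D.
Proof.
move=> [nF PF] zD.
have [p zpD] : exists p : nat, z.`_p \notin D.
  apply/not_existsP=> all_in; move/negP: zD; apply.
  rewrite -(prod_constt z); apply: group_prod => p _.
  by apply/negPn/negP; exact: all_in.
have zp_neq1 : z.`_p != 1 by apply: contraNneq zpD => ->; exact: group1.
have pz : p \in primes #[z].
  apply: contraNT zp_neq1 => pz; apply/eqP/constt1P.
  rewrite /p_elt /pnat order_gt0 /=; apply/allP=> r rz.
  by apply: contraNneq pz => <-.
have Pp : p \in P.
  have /pnatP := mem_p_elt PF (in_setT z); rewrite order_gt0 => /(_ isT).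
  by move: pz; rewrite mem_primes => /and3P[p_pr _ pz]; apply.
exists p => //.
set O := 'O_p^'([set: F])%G.
have nO : O <| [set: F] by exact: pcore_normal.
have NO x : x \in 'N(O) by rewrite (subsetP (normal_norm nO)) ?inE.
have qM : {morph coset O : x y / x * y} by move=> x y; rewrite morphM.
exists (coset_of O), (hom_of qM); split.
  have -> : [set: coset_of O] = [set: F] / O.
    apply/setP=> u; have [x _ ->] := cosetP u; rewrite inE.
    by rewrite mem_quotient ?inE.
  have /dprodP[_ defF _ _] := nilpotent_pcoreC p nF.
  rewrite -defF quotientMidr; apply: quotient_pgroup; exact: pcore_pgroup.
apply/imsetP=> -[d dD /= /esym eqdz].
have : coset O z.`_p = coset O d.`_p.
  rewrite (morph_constt (coset_morphism O)) //.
  rewrite (morph_constt (coset_morphism O)) //.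
  by rewrite [coset_morphism O d]eqdz.
move/(rcoset_kercosetP (NO _) (NO _)) => /rcosetP[o oO zdo].
have pF := nilpotent_pcore_Hall p nF.
have inp x : x.`_p \in 'O_p([set: F]).
  by rewrite (mem_normal_Hall pF) ?pcore_normal ?inE ?p_elt_constt.
(* [o] is in the [p']-core and is a quotient of elements of the [p]-core. *)
have o1 : o = 1.
  have tiO : 'O_p([set: F]) :&: 'O_p^'([set: F]) = 1.
    by rewrite coprime_TIg // coprime_pcoreC.
  apply/set1gP; rewrite -tiO inE oO andbT.
  have -> : o = z.`_p * (d.`_p)^-1 by rewrite zdo mulgK.
  by rewrite groupM ?groupV.
by move: zpD; rewrite zdo o1 mul1g groupX.
Qed.

Lemma FN_separation (P : nat_pred) (G : groupType) (D : groupClosed G) (x : G) :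
  is_separable (FN P) D -> x \notin D ->
  exists2 p, p \in P & exists (E : finGroupType) (f : {multiplicative G -> E}),
    p.-group [set: E] /\ forall y, y \in D -> f x <> f y.
Proof.
move=> sepD xD; have [Q [f [_ /FN_inv[F [g [g_inj nF]]] sep]]] := sepD x xD.
pose h : {multiplicative subgroup_type D -> F} := g \o f \o val.
have [|p Pp [E [k [pE kx]]]] :=
    nilpotent_separation (D := hom_image_group h) (z := g (f x)) nF.
  apply/hom_imageP=> -[y /= /g_inj fy]; apply: sep.
  by exists (val y); [exact: valP | rewrite fy].
exists p => //; exists E, (k \o g \o f); split=> // y yD /= kxy.
move/negP: kx; apply; rewrite kxy; apply: imset_f.
by apply/hom_imageP; exists (Sub y yD : subgroup_type D).
Qed.

(** * Wreath products *)

(** The wreath product for the right regular action of [Q].  The product is read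
    along paths in [Q]: [(x * y).1 u] follows [x] from [u] and then [y] from
    [u * x.2]. *)
Definition wreath (K : groupType) (Q : finGroupType) : Type :=
  ({ffun Q -> K} * Q)%type.

Section Wreath.
Variables (K : groupType) (Q : finGroupType).
Implicit Types x y z : wreath K Q.

HB.instance Definition _ := Choice.on (wreath K Q).

Definition wreath_one : wreath K Q := ([ffun=> 1], 1).

Definition wreath_mul x y : wreath K Q :=
  ([ffun u => x.1 u * y.1 (u * x.2)], x.2 * y.2).

Definition wreath_inv x : wreath K Q :=
  ([ffun u => (x.1 (u * x.2^-1))^-1], x.2^-1).

Lemma wreath_mulA : associative wreath_mul.
Proof.
move=> x y z; congr pair; last exact: mulgA.
by apply/ffunP=> u; rewrite !ffunE /= !mulgA.
Qed.

Lemma wreath_mul1g : left_id wreath_one wreath_mul.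
Proof.
case=> f q; congr pair; last exact: mul1g.
by apply/ffunP=> u; rewrite !ffunE /= mulg1 mul1g.
Qed.

Lemma wreath_mulg1 : right_id wreath_one wreath_mul.
Proof.
case=> f q; congr pair; last exact: mulg1.
by apply/ffunP=> u; rewrite !ffunE /= mulg1.
Qed.

Lemma wreath_mulVg : left_inverse wreath_one wreath_inv wreath_mul.
Proof.
case=> f q; congr pair; last exact: mulVg.
by apply/ffunP=> u; rewrite !ffunE /= mulVg.
Qed.

Lemma wreath_mulgV : right_inverse wreath_one wreath_inv wreath_mul.
Proof.
case=> f q; congr pair; last exact: mulgV.
by apply/ffunP=> u; rewrite !ffunE /= mulgK mulgV.
Qed.

HB.instance Definition _ := isGroup.Build (wreath K Q)
   wreath_mulA wreath_mul1g wreath_mulg1 wreath_mulVg wreath_mulgV.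

Lemma wreathM x y :
  x * y = ([ffun u => x.1 u * y.1 (u * x.2)], x.2 * y.2) :> wreath K Q.
Proof. by []. Qed.

Lemma wreath1 : 1 = ([ffun=> 1], 1) :> wreath K Q.
Proof. by []. Qed.

Lemma wreath_base_exp (g : wreath K Q) n :
  g.2 = 1 -> g ^+ n = ([ffun u => g.1 u ^+ n], 1).
Proof.
move=> g2; elim: n => [|n IHn].
  by congr pair; apply/ffunP=> u; rewrite !ffunE.
rewrite expgS IHn wreathM /= g2 mulg1; congr pair.
by apply/ffunP=> u; rewrite !ffunE mulg1 expgS.
Qed.

End Wreath.

Section FinWreath.
Variables (K Q : finGroupType).

HB.instance Definition _ := Finite.on (wreath K Q).

Lemma card_wreath : #|{: wreath K Q}| = (#|K| ^ #|Q| * #|Q|)%N.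
Proof. by rewrite card_prod card_ffun. Qed.

Lemma pgroup_wreath (p : nat) :
  p.-group [set: K] -> p.-group [set: Q] -> p.-group [set: wreath K Q].
Proof.
move=> pK pQ; rewrite /pgroup cardsT card_wreath pnatM; apply/andP; split.
  by rewrite pnatX -cardsT [_.-nat _]pK.
by rewrite -cardsT [_.-nat _]pQ.
Qed.

End FinWreath.

(** * Amalgamated products *)

Section Amalgam.
Variables (G : groupType) (A B H : groupClosed G).
Hypothesis amalgG : amalgamated_product A B H.

Lemma amalgamated_sym : amalgamated_product B A H.
Proof.
have [HAB univ] := amalgG; split=> [x|K f g fg]; first by rewrite HAB andbC.
have [|phi [phiA phiB] uniq] := univ K g f.
  by move=> a b eqab aH; rewrite (fg b a) -?eqab.
by exists phi => // psi psiB psiA; exact: uniq.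
Qed.

Lemma amalgamated_ext (K : groupType) (f g : {multiplicative G -> K}) :
  {in A, f =1 g} -> {in B, f =1 g} -> f =1 g.
Proof.
move=> fgA fgB x; have [_ univ] := amalgG.
have [|phi _ uniq] := univ K (g \o val) (g \o val); first by move=> a b /= ->.
rewrite (uniq f) ?(uniq g) //= => a.
  exact: fgA (valP a).
exact: fgB (valP a).
Qed.

Section Inclusion.
Variables (C D : groupClosed G) (CD : {subset C <= D}).

Definition inclusion_fun (x : subgroup_type C) : subgroup_type D :=
  Sub (val x) (CD (valP x)).

Lemma inclusionM : {morph inclusion_fun : x y / x * y}.
Proof. by move=> x y; exact: val_inj. Qed.

Definition inclusion : {multiplicative subgroup_type C -> subgroup_type D} :=
  hom_of inclusionM.

End Inclusion.

(** The pushout of [A] and [B] maps to any subgroup [S] containing both, and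
    composed with the inclusion of [S] this is the identity of [G]. *)
Lemma amalgamated_gen (S : groupClosed G) :
  {subset A <= S} -> {subset B <= S} -> forall x, x \in S.
Proof.
move=> AS BS x; have [_ univ] := amalgG.
have [|phi [phiA phiB] _] := univ _ (inclusion AS) (inclusion BS).
  by move=> a b eqab _; apply: val_inj.
have -> : x = val (phi x); last exact: valP.
suff: idfun =1 val \o phi by exact.
apply: amalgamated_ext => y yC /=.
  by rewrite -[y in RHS]/(val (Sub y yC : subgroup_type A)) phiA.
by rewrite -[y in RHS]/(val (Sub y yC : subgroup_type B)) phiB.
Qed.

(** The map on [A] is [a |-> (t, 1) * (r a, nu a) * (t, 1)^-1], with [r a] seen
    as a constant function, so it is a homomorphism for any [t]; the condition
    on [t] makes it agree on [H] with the map defined on [B]. *)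
Lemma twisted_wreath_hom (K : groupType) (Q : finGroupType)
    (nu : {multiplicative G -> Q}) (r : {multiplicative subgroup_type A -> K})
    (t : Q -> K) :
  (forall a : subgroup_type A, val a \in H ->
     forall u, t (u * nu (val a)) = t u * r a) ->
  exists Phi : {multiplicative G -> wreath K Q},
    [/\ forall a, Phi (val a) =
          ([ffun u => t u * r a * (t (u * nu (val a)))^-1], nu (val a)),
        forall b, b \in B -> Phi b = ([ffun=> 1], nu b)
      & forall x, (Phi x).2 = nu x].
Proof.
move=> tH.
have PhiAM : {morph (fun a : subgroup_type A =>
    ([ffun u => t u * r a * (t (u * nu (val a)))^-1], nu (val a)) : wreath K Q)
    : x y / x * y}.
  move=> a b; rewrite wreathM; congr pair; last by rewrite valM gmulfM.
  by apply/ffunP=> u; rewrite !ffunE valM !gmulfM !mulgA mulgVK.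
have PhiBM : {morph (fun b : subgroup_type B =>
    ([ffun=> 1], nu (val b)) : wreath K Q) : x y / x * y}.
  move=> a b; rewrite wreathM; congr pair; last by rewrite valM gmulfM.
  by apply/ffunP=> u; rewrite !ffunE mulg1.
have [|Phi [PhiA PhiB] _] := amalgG.2 _ (hom_of PhiAM) (hom_of PhiBM).
  move=> a b /= eqab aH; rewrite -eqab; congr pair; apply/ffunP=> u.
  by rewrite !ffunE tH // mulgV.
have PhiB' b : b \in B -> Phi b = ([ffun=> 1], nu b).
  by move=> bB; rewrite -[b]/(val (Sub b bB : subgroup_type B)) PhiB.
exists Phi; split=> // x.
have sndM : {morph (fun x => (Phi x).2) : x y / x * y}.
  by move=> y z; rewrite gmulfM.
suff: hom_of sndM =1 nu by exact.
apply: amalgamated_ext => y yC /=; last by rewrite PhiB'.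
by rewrite -[y in LHS]/(val (Sub y yC : subgroup_type A)) PhiA.
Qed.

Lemma sub_HA : {subset H <= A}.
Proof. by move=> x; rewrite amalgG.1 => /andP[]. Qed.

Lemma sub_HB : {subset H <= B}.
Proof. by move=> x; rewrite amalgG.1 => /andP[]. Qed.

(** The group [G] inherits from [H] quasi-regularity with respect to the
    factor [A].  On each left coset of [nu H], the function [t] is obtained by
    transporting [r] from a representative; this is well defined because
    [nu h = 1] forces [r h = 1].  An element [a] in the kernel of the resulting
    map has [nu a = 1] and [t 1 * r a / t 1 = 1]. *)
Lemma quasi_regular_factor (p : nat) (R : finGroupType)
    (r : {multiplicative subgroup_type A -> R}) :
  quasi_regular (Fp p) H -> p.-group [set: R] ->
  exists (W : finGroupType) (Phi : {multiplicative G -> W}),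
    p.-group [set: W] /\ forall a, Phi (val a) = 1 -> r a = 1.
Proof.
move=> qrH pR.
pose rH : {multiplicative subgroup_type H -> R} := r \o inclusion sub_HA.
have FM : Fp p (quotient_type (kernel rH)).
  have inj := kernel_lift_inj (f := rH).
  exact: (Fp_embed inj (periodic_inj inj ((pgroup_orders _ _).1 pR))).
have [N /Fp_inv[Q [f [f_inj pQ]]] NM] := qrH _ FM.
pose nu : {multiplicative G -> Q} := f \o proj N.
pose nuH : {multiplicative subgroup_type H -> Q} := nu \o val.
have nuH_inj (h : subgroup_type H) : nuH h = 1 -> rH h = 1.
  move=> nuh; apply/kernelP/NM/proj_eq1/f_inj.
  by rewrite hom1 -nuh.
pose HQ := hom_image_group nuH.
have /choice[eta etaE] : forall u : Q, exists h : subgroup_type H,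
    u = fingroup.repr (u *: HQ) * nuH h.
  move=> u.
  have /lcosetP[v /hom_imageP[h <-] ->] : fingroup.repr (u *: HQ) \in u *: HQ.
    by apply: mem_repr (lcoset_refl _ u).
  by exists h^-1; rewrite homV mulgK.
pose t u := rH (eta u).
have tH (a : subgroup_type A) : val a \in H ->
    forall u, t (u * nu (val a)) = t u * r a.
  move=> aH u; pose h : subgroup_type H := Sub (val a) aH.
  have -> : r a = rH h by congr (r _); apply: val_inj.
  rewrite -[nu _]/(nuH h) /t -gmulfM.
  apply: divg1_eq; rewrite -homF; apply: nuH_inj.
  rewrite homF gmulfM; apply/eqP; rewrite divg_eq1; apply/eqP.
  apply: (mulgI (fingroup.repr (u *: HQ))).
  have {1}-> : u *: HQ = (u * nuH h) *: HQ.
    by rewrite lcosetM (lcoset_id (mem_hom_image nuH h)).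
  by rewrite -etaE mulgA -etaE.
have [Phi [PhiA _ _]] := twisted_wreath_hom tH.
exists (wreath R Q), Phi; split; first exact: pgroup_wreath.
move=> a; rewrite PhiA wreath1 => -[/ffunP/(_ 1)]; rewrite !ffunE => ra nua.
apply: (mulgI (t 1)); apply: (mulIg (t 1)^-1).
by move: ra; rewrite nua mulg1 => ->; rewrite mulg1 mulgV.
Qed.

End Amalgam.

(** * Unitriangular groups and signed words *)

Section Unitriangular.
Local Open Scope ring_scope.
Variables (p n : nat).
Hypothesis p_pr : prime p.
Implicit Types M N T : 'M['F_p]_n.+1.

Definition unitriangular M : bool :=
  [forall i : 'I_n.+1, forall j : 'I_n.+1,
     (j <= i)%N ==> (M i j == (i == j)%:R)].

Lemma unitriangularP M :
  reflect (forall i j : 'I_n.+1, (j <= i)%N -> M i j = (i == j)%:R)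
          (unitriangular M).
Proof.
apply: (iffP forallP) => [uM i j ji|uM i].
  by have /forallP/(_ j)/implyP/(_ ji)/eqP := uM i.
by apply/forallP=> j; apply/implyP=> ji; rewrite uM.
Qed.

Lemma unitriangularM M N :
  unitriangular M -> unitriangular N -> unitriangular (M * N).
Proof.
move=> /unitriangularP uM /unitriangularP uN; apply/unitriangularP=> i j ji.
rewrite mxE (bigD1 i) //= uM // eqxx GRing.mul1r uN //.
rewrite big1 ?GRing.addr0 // => k ki.
have [lki|lik] := leqP k i.
  by rewrite uM // eq_sym (negPf ki) GRing.mul0r.
rewrite uN; last exact: leq_trans ji (ltnW lik).
rewrite -val_eqE /= gtn_eqF ?GRing.mulr0 //; exact: leq_ltn_trans ji lik.
Qed.

Lemma unitriangular1 : unitriangular 1.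
Proof. by apply/unitriangularP=> i j _; rewrite mxE. Qed.

(** Write [M = 1 + T] with [T] strictly upper triangular.  In characteristic
    [p], [M ^+ (p ^ k) = 1 + T ^+ (p ^ k)], and the last power vanishes as soon
    as [p ^ k] exceeds [n]. *)
Lemma unitriangular_pexp M : unitriangular M -> M ^+ (p ^ n.+1) = 1.
Proof.
move=> /unitriangularP uM; pose T := M - 1.
have defM : M = 1 + T by rewrite /T GRing.addrC GRing.subrK.
have T0 k (i j : 'I_n.+1) : (j < i + k)%N -> (T ^+ k) i j = 0.
  elim: k i j => [|k IHk] i j ltj.
    by rewrite GRing.expr0 mxE -val_eqE /= gtn_eqF // -[X in (_ < X)%N]addn0.
  rewrite GRing.exprSr mxE big1 // => l _.
  have [ltl|lel] := ltnP l (i + k)%N; first by rewrite IHk ?GRing.mul0r.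
  rewrite !mxE uM; first by rewrite GRing.subrr GRing.mulr0.
  by rewrite -ltnS (leq_trans ltj) // addnS ltnS.
have charM : p \in [pchar 'M['F_p]_n.+1].
  by rewrite GRing.pchar_lalg pchar_Fp.
have Tpk k : M ^+ (p ^ k) = 1 + T ^+ (p ^ k).
  elim: k => [|k IHk]; first by rewrite !GRing.expr1.
  rewrite expnSr GRing.exprM IHk -(GRing.pFrobenius_autE charM).
  rewrite GRing.pFrobenius_autD_comm; last exact/GRing.commr_sym/GRing.commr1.
  by rewrite GRing.pFrobenius_aut1 GRing.pFrobenius_autE -GRing.exprM.
rewrite Tpk -[RHS]GRing.addr0; congr (_ + _); apply/matrixP=> i j.
rewrite mxE T0 //; apply: leq_trans (ltn_ord j) _.
by apply: leq_trans (leq_addl _ _); apply: ltnW; rewrite ltn_expl ?prime_gt1.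
Qed.

Definition unitriangular_set : {set {unit 'M['F_p]_n.+1}} :=
  [set M | unitriangular (val M)].

Lemma unitriangular_group_set : group_set unitriangular_set.
Proof.
apply/group_setP; split=> [|M N]; rewrite !inE; first exact: unitriangular1.
exact: unitriangularM.
Qed.

Canonical unitriangular_group := Group unitriangular_group_set.

Lemma pgroup_unitriangular : p.-group unitriangular_group.
Proof.
apply/pgroupP=> q q_pr /(Cauchy q_pr)[M]; rewrite inE => uM oM.
have : (#[M]%g %| p ^ n.+1)%N.
  rewrite order_dvdn; apply/eqP/val_inj.
  by rewrite FinRing.val_unitX unitriangular_pexp.
rewrite oM => /(dvdn_trans (dvdnn q)); rewrite Euclid_dvdX // => /andP[+ _].
by rewrite dvdn_prime2.
Qed.

End Unitriangular.

Definition signed_prod (K : groupType) (E : Type) (t : E -> K)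
    (w : seq (E * bool)) : K :=
  foldr (fun es k => (if es.2 then t es.1 else (t es.1)^-1) * k) 1 w.

Definition letters_alternate (E : eqType) (w : seq (E * bool)) :=
  sorted (fun x y => x.1 != y.1) w.

(** A word of length [n] is detected on [n + 1] coordinates: its letter [e] acts
    as [1 + X e], where [X e] moves coordinate [i + 1] to coordinate [i] exactly
    when [e] is the letter number [i] of the word.  Each factor of the product
    lowers a coordinate by at most one, hence the last coordinate reaches the
    first one only if every factor contributes its shift, and the corner entry
    of the product is 1 or -1. *)
Section Magnus.
Local Open Scope ring_scope.
Variables (p : nat) (E : eqType) (e0 : E) (w : seq (E * bool)).
Hypotheses (p_pr : prime p) (w_alt : letters_alternate w).
Let n := size w.
Implicit Types M N T : 'M['F_p]_n.+1.

Definition magnus_shift (e : E) : 'M['F_p]_n.+1 :=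
  \matrix_(i, j) ((j == i.+1 :> nat) && ((nth (e0, true) w i).1 == e))%:R.

(** This is where the word being reduced matters: no letter occurs at two
    consecutive places.  So the inverse of [1 + X e] is [1 - X e], and inverse
    letters shift just like letters, up to sign. *)
Lemma magnus_shift_sqr e : magnus_shift e * magnus_shift e = 0.
Proof.
apply/matrixP=> i j; rewrite !mxE big1 // => k _.
rewrite !mxE -GRing.natrM mulnb.
case: eqP => //= ki; case: eqP => //= wi.
case: eqP => //= jk; case: eqP => //= wk.
have ltk : (i.+1 < size w)%N.
  by have := ltn_ord j; rewrite jk ki ltnS.
have := w_alt; rewrite /letters_alternate => /(sortedP (e0, true))/(_ i ltk).
by rewrite -ki wi wk eqxx.
Qed.

Definition magnus_mx e (s : bool) : 'M['F_p]_n.+1 :=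
  if s then 1 + magnus_shift e else 1 - magnus_shift e.

Lemma magnus_mxK e s : magnus_mx e s * magnus_mx e (~~ s) = 1.
Proof.
case: s; rewrite /magnus_mx /=.
  by rewrite GRing.mulrBr GRing.mulr1 GRing.mulrDl GRing.mul1r magnus_shift_sqr
             GRing.addr0 GRing.addrK.
by rewrite GRing.mulrDr GRing.mulr1 GRing.mulrBl GRing.mul1r magnus_shift_sqr
           GRing.subr0 GRing.subrK.
Qed.

Lemma unitriangular_magnus e s : unitriangular (magnus_mx e s).
Proof.
apply/unitriangularP=> i j ji; rewrite /magnus_mx.
have X0 : magnus_shift e i j = 0.
  by rewrite mxE ltn_eqF // ltnS.
by case: s; rewrite !mxE in X0 *; rewrite X0 ?GRing.subr0 ?GRing.addr0.
Qed.

Lemma magnus_unit e : magnus_mx e true \is a GRing.unit.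
Proof.
apply/GRing.unitrP; exists (magnus_mx e false).
by rewrite (magnus_mxK e true) (magnus_mxK e false).
Qed.

Definition magnus e : subg_of (unitriangular_group p n) :=
  subg (unitriangular_group p n) (FinRing.unit _ (magnus_unit e)).

Lemma val_magnus e (s : bool) :
  val (sgval (if s then magnus e else (magnus e)^-1)%g) = magnus_mx e s.
Proof.
have Ve : val (sgval (magnus e)) = magnus_mx e true.
  by rewrite subgK // inE unitriangular_magnus.
case: s => //; rewrite -[sgval _]/((sgval (magnus e))^-1)%g.
rewrite FinRing.val_unitV Ve.
apply: (GRing.mulrI (magnus_unit e)).
by rewrite GRing.mulrV ?magnus_unit // (magnus_mxK e true).
Qed.

(** Induction over the suffixes of [w]: the last column of the product of the
    letters from place [k] on starts exactly at row [k]. *)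
Lemma magnus_prod_suffix k (v : seq (E * bool)) (kn : (k < n.+1)%N) :
  drop k w = v ->
  (forall j : 'I_n.+1, (j < k)%N ->
     val (sgval (signed_prod magnus v)) j ord_max = 0) /\
  val (sgval (signed_prod magnus v)) (Ordinal kn) ord_max != 0.
Proof.
elim: v k kn => [|[e s] v IHv] k kn dropw.
  have kE : k = n.
    have := size_drop k w; rewrite dropw /= => /esym/eqP.
    rewrite subn_eq0 => nk.
    by apply/eqP; rewrite eqn_leq nk andbT -ltnS.
  have -> : Ordinal kn = ord_max by exact: val_inj.
  split=> [j jk|]; rewrite mxE ?eqxx ?GRing.oner_eq0 //.
  by rewrite -val_eqE /= ltn_eqF // (leq_trans jk) // kE.
have ltk : (k < n)%N by rewrite -subn_gt0 -[n]/(size w) -size_drop dropw.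
have wk : nth (e0, true) w k = (e, s).
  by rewrite -[k]addn0 -nth_drop dropw.
have kn1 : (k.+1 < n.+1)%N by [].
have [|IH0 IHk] := IHv k.+1 kn1.
  by rewrite -add1n -drop_drop dropw /= drop0.
set N := val _ in IH0 IHk *.
have -> : val (sgval (signed_prod magnus ((e, s) :: v))) = magnus_mx e s * N.
  by rewrite -val_magnus -FinRing.val_unitM.
pose X := magnus_shift e * N.
have mulE j : (magnus_mx e s * N) j ord_max =
    N j ord_max + (if s then X j ord_max else - X j ord_max).
  rewrite /magnus_mx; case: (s).
    by rewrite GRing.mulrDl GRing.mul1r [LHS]mxE.
  by rewrite GRing.mulrBl GRing.mul1r [LHS]mxE [Y in _ + Y = _]mxE.
split=> [j jk|].
  rewrite mulE IH0; last exact: ltnW.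
  rewrite GRing.add0r.
  suff -> : X j ord_max = 0 by rewrite GRing.oppr0 if_same.
  rewrite mxE big1 // => i _; rewrite mxE.
  have [ij|] /= := eqVneq (i : nat) j.+1; last by rewrite GRing.mul0r.
  by rewrite IH0 ?GRing.mulr0 // ij.
rewrite mulE IH0 //= GRing.add0r.
have -> : X (Ordinal kn) ord_max = N (Ordinal kn1) ord_max.
  rewrite mxE (bigD1 (Ordinal kn1)) //= mxE /= wk !eqxx GRing.mul1r.
  rewrite big1 ?GRing.addr0 // => i; rewrite -val_eqE /= => /negPf ik.
  by rewrite mxE ik GRing.mul0r.
by case: (s); rewrite ?GRing.oppr_eq0.
Qed.

Lemma magnus_separation :
  w != [::] ->
  exists (K : finGroupType) (t : E -> K),
    p.-group [set: K] /\ signed_prod t w != 1%g.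
Proof.
move=> w_neq0.
exists (subg_of (unitriangular_group p n)), magnus; split.
  by rewrite /pgroup -(card_isog (isog_subg _)); exact: pgroup_unitriangular.
have [_] := magnus_prod_suffix (ltn0Sn n) (drop0 w).
apply: contraNneq => ->; rewrite mxE -val_eqE /=.
by rewrite /n; case: (w) w_neq0.
Qed.

End Magnus.

(** * Reduced words *)

Section Words.
Variables (G : groupType) (A B H : groupClosed G).
Hypothesis amalgG : amalgamated_product A B H.

Definition word_value (b : G) (s : seq (G * G)) : G :=
  b * foldr (fun ab y => ab.1 * ab.2 * y) 1 s.

(** Only syllables between two letters from [A] are kept out of [H] on the side
    of [B]: these are the ones that keep consecutive edges distinct below. *)
Fixpoint reduced (s : seq (G * G)) : bool :=
  if s is (a, b) :: s' then
    [&& a \in A, a \notin H, b \in B, (b \notin H) || nilp s' & reduced s']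
  else true.

Definition has_reduced_word (x : G) : Prop :=
  exists b s, [/\ b \in B, reduced s & x = word_value b s].

Lemma word_value_cons b a c s :
  word_value b ((a, c) :: s) = b * a * word_value c s.
Proof. by rewrite /word_value /= !mulgA. Qed.

Let HA := sub_HA amalgG.
Let HB := sub_HB amalgG.

(** Syllables that fall into [H] are absorbed by the neighbouring syllables. *)
Lemma reduced_word_mulA a x :
  a \in A -> has_reduced_word x -> has_reduced_word (a * x).
Proof.
move=> aA [b [s [bB rs ->]]].
have [aH|aNH] := boolP (a \in H).
  by exists (a * b), s; rewrite gpredM ?(HB aH) // /word_value mulgA.
have [bH|bNH] := boolP (b \in H); last first.
  exists 1, ((a, b) :: s).
  by rewrite gpred1 /= aA aNH bB bNH word_value_cons mul1g.
case: s rs => [|[a1 b1] s] /=.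
  exists 1, [:: (a, b)].
  by rewrite gpred1 /= aA aNH bB orbT word_value_cons mul1g.
move=> /and5P[a1A a1H b1B b1H rs].
have abA : a * b * a1 \in A by rewrite !gpredM ?(HA bH).
have [abH|abNH] := boolP (a * b * a1 \in H).
  exists (a * b * a1 * b1), s; rewrite gpredM ?(HB abH) // word_value_cons.
  by rewrite /word_value !mulgA.
exists 1, ((a * b * a1, b1) :: s); rewrite gpred1 /= abA abNH b1B b1H rs.
by rewrite !word_value_cons mul1g !mulgA.
Qed.

Lemma reduced_word_mulB c x :
  c \in B -> has_reduced_word x -> has_reduced_word (c * x).
Proof.
move=> cB [b [s [bB rs ->]]]; exists (c * b), s.
by rewrite gpredM // /word_value mulgA.
Qed.

(** The elements preserving, in both directions, the set of values of reduced
    words form a subgroup containing the two factors. *)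
Lemma reduced_word_exists x : has_reduced_word x.
Proof.
pose S : {pred G} := fun y =>
  `[< forall z, has_reduced_word (y * z) <-> has_reduced_word z >].
have S_closed : group_closed S.
  split=> [|y z /asboolP Sy /asboolP Sz]; apply/asboolP=> u.
    by rewrite mul1g.
  by rewrite -mulgA Sy -[in X in _ <-> X](mulVKg z u) Sz.
have CS (C : groupClosed G) :
    (forall c y, c \in C -> has_reduced_word y -> has_reduced_word (c * y)) ->
    {subset C <= closed_of S_closed}.
  move=> mulC c cC; apply/asboolP=> y; split; last exact: mulC.
  by rewrite -{2}[y](mulKg c); apply: mulC; rewrite gpredV.
have /asboolP/(_ 1) :=
  amalgamated_gen amalgG (CS A reduced_word_mulA) (CS B reduced_word_mulB) x.
by rewrite mulg1 => ->; exists 1, [::]; rewrite gpred1 /word_value mulg1.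
Qed.

End Words.

Section Detect.
Variables (G : groupType) (A B H : groupClosed G).
Hypothesis amalgG : amalgamated_product A B H.
Variables (Q : finGroupType) (nu : {multiplicative G -> Q}).

Let HQ := hom_image_group (nu \o val : {multiplicative subgroup_type H -> Q}).

(** The case [r = 1] of the twisted homomorphism.  In the language of Bass and
    Serre, [t] labels the edges of the quotient of the tree by the kernel of
    [nu]; if [nu] is onto, these edges are the left cosets of [nu H]. *)
Lemma edge_hom (K : groupType) (t : Q -> K) :
  (forall h, h \in H -> forall u, t (u * nu h) = t u) ->
  exists Phi : {multiplicative G -> wreath K Q},
    [/\ forall a, a \in A ->
          Phi a = ([ffun u => t u * (t (u * nu a))^-1], nu a),
        forall b, b \in B -> Phi b = ([ffun=> 1], nu b)
      & forall x, (Phi x).2 = nu x].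
Proof.
move=> tH.
have oneM : {morph (fun _ : subgroup_type A => 1 : K) : x y / x * y}.
  by move=> x y; rewrite mulg1.
have [|Phi [PhiA PhiB Phi2]] :=
    twisted_wreath_hom amalgG (nu := nu) (r := hom_of oneM) (t := t).
  by move=> a aH u; rewrite mulg1 tH.
exists Phi; split=> // a aA.
rewrite -[a]/(val (Sub a aA : subgroup_type A)) PhiA.
by congr pair; apply/ffunP=> u; rewrite !ffunE mulg1.
Qed.

(** The edges crossed by the path that starts at [u] and follows the word [s],
    with their directions. *)
Fixpoint word_letters (u : Q) (s : seq (G * G)) : seq ({set Q} * bool) :=
  if s is (a, b) :: s' then
    [:: (u *: HQ, true), (u * nu a *: HQ, false)
      & word_letters (u * nu a * nu b) s']
  else [::].

Definition separates_word (s : seq (G * G)) :=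
  forall a b, (a, b) \in s ->
    (a \notin H -> nu a \notin HQ) /\ (b \notin H -> nu b \notin HQ).

Lemma lcoset_neq u q : q \notin HQ -> u *: HQ != u * q *: HQ.
Proof.
apply: contraNneq => uq; rewrite -[q](mulKg u) -mem_lcoset uq.
exact: lcoset_refl.
Qed.

Lemma word_letters_alternate u s :
  reduced A B H s -> separates_word s -> letters_alternate (word_letters u s).
Proof.
rewrite /letters_alternate.
elim: s u => [|[a b] s IHs] u //= /and5P[_ aH bB bH rs] sep.
have [nua nub] := sep a b (mem_head _ _).
have /IHs -/(_ (u * nu a * nu b) rs) : separates_word s.
  by move=> a' b' s'; apply: sep; rewrite in_cons s' orbT.
rewrite lcoset_neq ?nua //=.
case: s bH {IHs rs sep} => [|[a' b'] s] //=; rewrite orbF => bH ->.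
by rewrite lcoset_neq ?nub.
Qed.

(** A syllable from [A] at [u] contributes [t (u H) / t (u a H)] and a syllable
    from [B] only moves the base point. *)
Lemma edge_hom_word (K : groupType) (t : {set Q} -> K)
    (Phi : {multiplicative G -> wreath K Q}) :
    (forall a, a \in A ->
       Phi a = ([ffun u => t (u *: HQ) * (t (u * nu a *: HQ))^-1], nu a)) ->
    (forall b, b \in B -> Phi b = ([ffun=> 1], nu b)) ->
  forall b s u, b \in B -> reduced A B H s ->
  (Phi (word_value b s)).1 u = signed_prod t (word_letters (u * nu b) s).
Proof.
move=> PhiA PhiB b s u bB; elim: s b u bB => [|[a c] s IHs] b u bB /=.
  by rewrite /word_value mulg1 PhiB // ffunE.
move=> /and5P[aA _ cB _ rs]; rewrite word_value_cons.
have := IHs c (u * nu b * nu a) cB rs; move: (word_value c s) => y IHy.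
rewrite !gmulfM (PhiA a) // (PhiB b) // !wreathM /= !ffunE mul1g mulgA IHy.
by rewrite mulgA.
Qed.

(** A nonempty reduced word whose syllables are separated from [H] by [nu]
    spells a reduced word in the edges, which some labelling by a finite
    [p]-group does not send to 1. *)
Lemma word_detection (p : nat) b s :
  prime p -> b \in B -> reduced A B H s -> s != [::] -> separates_word s ->
  exists (K : finGroupType) (Phi : {multiplicative G -> wreath K Q}),
    [/\ p.-group [set: K], Phi (word_value b s) != 1,
        forall x, (Phi x).2 = nu x
      & forall x, (x \in A) || (x \in B) -> nu x = 1 -> Phi x = 1].
Proof.
move=> p_pr bB rs s_neq0 sep.
pose w := word_letters (1 * nu b) s.
have [||K [t [pK tw]]] := magnus_separation (w := w) set0 p_pr.
- exact: word_letters_alternate.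
- by rewrite /w; case: (s) s_neq0 => // -[].
have [|Phi [PhiA PhiB Phi2]] := edge_hom (t := fun u => t (u *: HQ)).
  move=> h hH u; congr t; rewrite lcosetM; congr (_ *: _); apply: lcoset_id.
  by apply/hom_imageP; exists (Sub h hH : subgroup_type H).
exists K, Phi; split=> //.
  apply: contraNneq tw => Phi1; rewrite -(edge_hom_word PhiA PhiB) //.
  by rewrite Phi1 wreath1 ffunE.
move=> x /orP[xA|xB] nux; last by rewrite PhiB // nux.
rewrite PhiA // nux wreath1.
by congr pair; apply/ffunP=> u; rewrite !ffunE mulg1 mulgV.
Qed.

End Detect.

(** * Freeness of the kernel *)

(** Let [nu] be injective on both factors.  Take transversals [alpha i] of the
    kernel of [nu], one for each factor, that commute with right
    multiplication by the elements of that factor.  The elements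
    [s u = alpha false u / alpha true u] generate the kernel, and [s] is
    constant on the cosets [u H], the edges of the graph with vertices [u A] and
    [u B].  If the edges with [s u = 1] connect all the vertices, then the other
    [s u] are free generators. *)
Section FreeKernel.
Variables (Y : groupType) (A B H : groupClosed Y).
Hypothesis amalgY : amalgamated_product A B H.
Variables (Q : finGroupType) (nu : {multiplicative Y -> Q}).
Hypotheses (nu_surj : surjective nu)
  (nuA_inj : forall a, a \in A -> nu a = 1 -> a = 1)
  (nuB_inj : forall b, b \in B -> nu b = 1 -> b = 1).

Definition factor (i : bool) : groupClosed Y := if i then A else B.

Let factor_inj i x y : x \in factor i -> y \in factor i -> nu x = nu y -> x = y.
Proof.
move=> xF yF nuxy; apply: divg1_eq; have xyF := gpredF xF yF.
have: nu (x * y^-1) = 1 by rewrite homF nuxy mulgV.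
by case: (i) xyF; [exact: nuA_inj | exact: nuB_inj].
Qed.

(** A partial pair of transversals, over the sets [V i] of already reached
    points.  The last field is an induction principle which says that the edges
    where the two transversals agree connect all the reached vertices. *)
Record schreier_system (V : bool -> {set Q}) (alpha : bool -> Q -> Y) :
    Prop := {
  schreier_base i : 1 \in V i /\ alpha i 1 = 1;
  schreier_stable i u x : u \in V i -> x \in factor i -> u * nu x \in V i;
  schreier_equivariant i u x : u \in V i -> x \in factor i ->
    alpha i (u * nu x) = alpha i u * x;
  schreier_section i u : u \in V i -> nu (alpha i u) = u;
  schreier_connected (X : bool -> Q -> Prop) :
    (forall i, X i 1) ->
    (forall i u x, u \in V i -> x \in factor i -> X i u -> X i (u * nu x)) ->
    (forall i u, u \in V i -> u \in V (~~ i) -> alpha i u = alpha (~~ i) u ->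
       X (~~ i) u -> X i u) ->
    forall i u, u \in V i -> X i u
}.

Lemma factor_inverse : exists gamma : bool -> Q -> Y,
  forall i x, x \in factor i -> gamma i (nu x) = x.
Proof.
have /choice[g gP] : forall iw : bool * Q, exists y,
    forall x, x \in factor iw.1 -> nu x = iw.2 -> y = x.
  move=> [i w]; have [[x [xF xw]]|no] :=
      pselect (exists x, x \in factor i /\ nu x = w).
    by exists x => y yF yw; apply: (factor_inj xF yF); rewrite xw yw.
  by exists 1 => x xF xw; case: no; exists x.
by exists (fun i w => g (i, w)) => i x xF; exact: (gP (i, nu x) x).
Qed.

(** Initially only the two vertices through 1 are reached, and each transversal
    is the inverse of [nu] on its factor. *)
Lemma schreier_start : exists V alpha, schreier_system V alpha.
Proof.
have [gamma gammaE] := factor_inverse.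
exists (fun i => [set w | `[< exists x, x \in factor i /\ nu x = w >]]), gamma.
split=> [i|i u x|i u x|i u|X X1 Xstable _ i u].
- split; last by rewrite -(hom1 nu) gammaE ?gpred1.
  by rewrite inE; apply/asboolP; exists 1; rewrite gpred1 hom1.
- rewrite !inE => /asboolP[y [yF <-]] xF; apply/asboolP.
  by exists (y * x); rewrite gpredM ?gmulfM.
- rewrite inE => /asboolP[y [yF <-]] xF.
  by rewrite -gmulfM !gammaE ?gpredM.
- by rewrite inE => /asboolP[y [yF <-]]; rewrite gammaE.
- rewrite inE => /asboolP[y [yF <-]]; rewrite -[nu y]mul1g.
  apply: Xstable (X1 i) => //; rewrite inE; apply/asboolP.
  by exists 1; rewrite gpred1 hom1.
Qed.

Lemma schreier_stableE V alpha i u x : schreier_system V alpha ->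
  x \in factor i -> (u * nu x \in V i) = (u \in V i).
Proof.
move=> sys xF; apply/idP/idP => [uxV|uV]; last first.
  exact: schreier_stable sys _ _ _ uV xF.
by rewrite -[u](mulgK (nu x)) -homV (schreier_stable sys) ?gpredV.
Qed.

(** An edge at [u] leads to a new vertex: there the new transversal starts from
    the value at [u] of the other one, so the two agree on this edge. *)
Lemma schreier_step V alpha i u : schreier_system V alpha ->
  u \in V (~~ i) -> u \notin V i ->
  exists V' alpha',
    [/\ schreier_system V' alpha', forall j, V j \subset V' j & u \in V' i].
Proof.
move=> sys uV uNV; have [gamma gammaE] := factor_inverse.
pose C := [set w | `[< exists x, x \in factor i /\ u * nu x = w >]].
pose V' j := if j == i then V i :|: C else V j.
pose alpha' j v :=
  if (j == i) && (v \notin V i) then alpha (~~ i) u * gamma i (u^-1 * v)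
  else alpha j v.
have CP x : x \in factor i -> u * nu x \in C.
  by move=> xF; rewrite inE; apply/asboolP; exists x.
have uC : u \in C by rewrite -[u]mulg1 -(hom1 nu) CP ?gpred1.
have VV' j v : v \in V j -> v \in V' j.
  by rewrite /V'; case: eqP => // -> vV; rewrite inE vV.
have alphaV j v : v \in V j -> alpha' j v = alpha j v.
  by rewrite /alpha'; case: eqP => //= -> ->.
have alphaC x : x \in factor i -> alpha' i (u * nu x) = alpha (~~ i) u * x.
  move=> xF; rewrite /alpha' eqxx (schreier_stableE _ sys xF) uNV /=.
  by rewrite mulKg gammaE.
have V'P j v : v \in V' j ->
    v \in V j \/ j = i /\ exists2 x, x \in factor i & v = u * nu x.
  rewrite /V'; case: eqP => [->|_]; last by left.
  rewrite inE => /orP[|]; first by left.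
  by rewrite inE => /asboolP[x [xF <-]]; right; split=> //; exists x.
exists V', alpha'; split; last by rewrite /V' eqxx inE uC orbT.
  split=> [j|j v x|j v x|j v|X X1 Xstable Xcross].
  - have [V1 a1] := schreier_base sys j.
    by split; [exact: VV' | rewrite alphaV].
  - case/V'P=> [vV|[-> [y yF ->]]] xF.
      by apply: VV'; rewrite (schreier_stable sys).
    by rewrite -mulgA -gmulfM /V' eqxx inE CP ?orbT ?gpredM.
  - case/V'P=> [vV|[-> [y yF ->]]] xF.
      by rewrite !alphaV ?(schreier_stable sys) ?(schreier_equivariant sys).
    by rewrite -[_ * nu y * _]mulgA -gmulfM !alphaC ?gpredM // mulgA.
  - case/V'P=> [vV|[-> [y yF ->]]].
      by rewrite alphaV ?(schreier_section sys).
    by rewrite alphaC // gmulfM (schreier_section sys).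
  - have XV j v : v \in V j -> X j v.
      apply: (schreier_connected sys) => // [k w x wV|k w wV wV' ak].
        by apply: Xstable; exact: VV'.
      by apply: Xcross; rewrite ?VV' // !alphaV.
    move=> j v /V'P[/XV //|[-> [x xF ->]]].
    have uV'i : u \in V' i by rewrite /V' eqxx inE uC orbT.
    apply: Xstable => //; apply: Xcross => //; [exact: VV' | | exact: XV].
    have := alphaC 1 gpred1; rewrite hom1 !mulg1 => ->.
    by rewrite alphaV.
by move=> j; apply/subsetP=> v; exact: VV'.
Qed.

(** A set stable under both factors is stable under [G], hence full because
    [nu] is onto. *)
Lemma schreier_total V alpha : schreier_system V alpha ->
  V true = V false -> forall i u, u \in V i.
Proof.
move=> sys VE i u; have VE' j : V j = V i by case: i j => [] [].
pose S : {pred Y} := fun y => [forall v, (v * nu y \in V i) == (v \in V i)].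
have SP y : reflect (forall v, (v * nu y \in V i) = (v \in V i)) (y \in S).
  by apply: (iffP forallP) => Sy v; apply/eqP.
have S_closed : group_closed S.
  split=> [|x y /SP Sx /SP Sy]; apply/SP=> v; first by rewrite hom1 mulg1.
  by rewrite gmulfM mulgA -Sy homV mulgVK Sx.
have FS j : {subset factor j <= closed_of S_closed}.
  by move=> x xF; apply/SP=> v; rewrite -(VE' j) (schreier_stableE _ sys).
have [y <-] := nu_surj u; have [V1 _] := schreier_base sys i.
have /SP/(_ 1) := amalgamated_gen amalgY (FS true) (FS false) y.
by rewrite mul1g V1.
Qed.

Lemma schreier_exists : exists alpha, schreier_system (fun=> setT) alpha.
Proof.
suff grow n V alpha : schreier_system V alpha ->
    (#|~: V true| + #|~: V false| <= n)%N ->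
    exists alpha', schreier_system (fun=> setT) alpha'.
  by have [V [alpha sys]] := schreier_start; exact: grow sys (leqnn _).
elim: n V alpha => [|n IHn] V alpha sys.
  rewrite leqn0 addn_eq0 !cards_eq0 => /andP[/eqP Vt /eqP Vf].
  have VT : V = fun=> setT.
    by apply/funext=> -[]; apply: setC_inj; rewrite setCT ?Vt ?Vf.
  by exists alpha; rewrite -VT.
move=> leV; have [[i [u [uV uNV]]]|no] :=
    pselect (exists i u, u \in V (~~ i) /\ u \notin V i).
  have [V' [alpha' [sys' VV' uV']]] := schreier_step sys uV uNV.
  apply: (IHn _ _ sys'); rewrite -ltnS; apply: leq_trans leV.
  have le j : #|~: V' j| <= #|~: V j| by rewrite subset_leq_card ?setCS.
  have lt : #|~: V' i| < #|~: V i|.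
    rewrite proper_card // properE setCS VV'; apply/subsetPn.
    by exists u; rewrite !inE ?uNV ?uV'.
  case: i lt {uV uNV uV'} => lt; first by rewrite -addSn leq_add.
  by rewrite -addnS leq_add.
have VE : V true = V false.
  apply/setP=> u; apply/idP/idP=> uV; apply/negPn/negP=> uNV; apply: no.
    by exists false, u.
  by exists true, u.
have VT : V = fun=> setT.
  by apply/funext=> i; apply/setP=> u; rewrite inE (schreier_total sys VE).
by exists alpha; rewrite -VT.
Qed.

(** Existence: given the images of the generators, label the edge [u] with the
    image of [s u], or with 1 if [s u = 1].  The map to the wreath product
    restricts, at the base point, to a homomorphism [phi] on the kernel.
    Connectedness shows by induction that [phi] is 1 on [alpha false u] and
    [(t u)^-1] on [alpha true u], hence [t u] on [s u].  Uniqueness: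
    [alpha false u * y / alpha false (u * nu y)] lies in the subgroup generated
    by the [s u] when [y] is in a factor, hence for all [y], and this element
    is [y] if [u = 1] and [nu y = 1]. *)
Lemma free_kernel : is_free (subgroup_type (kernel nu)).
Proof.
have [alpha sys] := schreier_exists.
pose s u := alpha false u * (alpha true u)^-1.
have nu_alpha i u : nu (alpha i u) = u.
  by apply: (schreier_section sys); rewrite inE.
have sker u : s u \in (kernel nu : groupClosed Y).
  by apply/kernelP; rewrite homF !nu_alpha mulgV.
pose sK u : subgroup_type (kernel nu) := Sub (s u) (sker u).
have alphaM i u x : x \in factor i -> alpha i (u * nu x) = alpha i u * x.
  by move=> xF; apply: (schreier_equivariant sys); rewrite ?inE.
have alpha1 i : alpha i 1 = 1 by have [] := schreier_base sys i.
have sH h u : h \in H -> s (u * nu h) = s u.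
  move=> hH; rewrite /s !alphaM ?(sub_HA amalgY hH) ?(sub_HB amalgY hH) //.
  by rewrite invgM mulgA mulgK.
exists (fun z => (z != 1) && [exists u, z == sK u]) => K f.
pose t u := if s u == 1 then 1 else f (sK u).
have [|Phi [PhiA PhiB Phi2]] := edge_hom amalgY (nu := nu) (t := t).
  move=> h hH u; rewrite /t sH //; congr (if _ then _ else f _).
  by apply: val_inj; rewrite /= sH.
pose phi y := (Phi y).1 1.
have phiM y z : phi (y * z) = phi y * (Phi z).1 (nu y).
  by rewrite /phi gmulfM wreathM /= ffunE Phi2 mul1g.
have t1 u : alpha true u = alpha false u -> t u = 1.
  by move=> alphau; rewrite /t /s alphau mulgV eqxx.
have phi_alpha i u : phi (alpha i u) * (if i then t u else 1) = 1.
  pose X i u := phi (alpha i u) * (if i then t u else 1) = 1.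
  apply: (schreier_connected sys (X := X)); rewrite ?inE // /X.
  - move=> j; rewrite alpha1 /phi (hom1 Phi) wreath1 ffunE mul1g.
    by case: j; rewrite // t1 // !alpha1.
  - move=> j v x _ xF Xv; rewrite -[RHS]Xv alphaM // phiM nu_alpha.
    case: j {Xv} xF => xF; last by rewrite PhiB // ffunE mulg1.
    by rewrite PhiA //= ffunE mulgA mulgVK.
  - move=> j v _ _ alphav Xv; rewrite -[RHS]Xv alphav; congr (_ * _).
    by case: j {Xv} alphav => alphav; rewrite t1.
have psiM :
    {morph (fun z : subgroup_type (kernel nu) => phi (val z)) : x y / x * y}.
  by move=> x y; rewrite /= phiM (elimT (kernelP nu _) (valP x)).
have psi_s u : phi (s u) = t u.
  have := phi_alpha false u; rewrite mulg1.
  rewrite -[alpha false u](mulgVK (alpha true u)) -/(s u) phiM.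
  rewrite (elimT (kernelP nu _) (sker u)) -/(phi _).
  move/(congr1 (fun k => k * t u)); rewrite -mulgA (phi_alpha true).
  by rewrite mulg1 mul1g.
exists (hom_of psiM) => [z /andP[z_neq1 /existsP[u /eqP defz]] | psi psiS z] /=.
  by rewrite defz psi_s /t; move: z_neq1; rewrite defz -val_eqE /= => /negPf->.
pose D : {pred Y} := fun y =>
  `[< exists2 z : subgroup_type (kernel nu), val z = y & psi z = phi y >].
have D_closed : group_closed D.
  split=> [|_ _ /asboolP[x <- psix] /asboolP[y <- psiy]]; apply/asboolP.
    by exists 1; rewrite ?hom1 // /phi (hom1 Phi) wreath1 ffunE.
  exists (x * y^-1); first by rewrite valM homV.
  rewrite homF psix psiy -[RHS]/(hom_of psiM (x * y^-1)).
  by rewrite homF.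
have sD u : s u \in closed_of D_closed.
  apply/asboolP; exists (sK u) => //; rewrite psi_s /t; case: eqP => [su1|su1].
    by rewrite -(hom1 psi); congr (psi _); exact: val_inj.
  rewrite psiS //; apply/andP; split; first by rewrite -val_eqE; exact/eqP.
  by apply/existsP; exists u.
pose E : {pred Y} := fun y =>
  [forall u,
     alpha false u * y * (alpha false (u * nu y))^-1 \in closed_of D_closed].
have E_closed : group_closed E.
  split=> [|x y /forallP Ex /forallP Ey]; apply/forallP=> u.
    by rewrite hom1 !mulg1 mulgV gpred1.
  have := gpredF (Ex u) (Ey (u * nu (x * y^-1))).
  rewrite homF -[_ * nu y]mulgA mulgVK.
  by rewrite !invgM !invgK !mulgA mulgVK.
have EA : {subset A <= closed_of E_closed}.
  move=> a aA; apply/forallP=> u.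
  have := gpredF (sD u) (sD (u * nu a)).
  rewrite /s (alphaM true) // !invgM !invgK !mulgA.
  by rewrite -[_ * (alpha true u)^-1 * _]mulgA mulVg mulg1.
have EB : {subset B <= closed_of E_closed}.
  by move=> b bB; apply/forallP=> u; rewrite (alphaM false) // mulgV gpred1.
have /forallP/(_ 1) := amalgamated_gen amalgY EA EB (val z).
rewrite mul1g (elimT (kernelP nu _) (valP z)) alpha1 mul1g invg1 mulg1.
by case/asboolP=> z' /val_inj-> ->.
Qed.

End FreeKernel.

(** * Quotients of amalgamated products *)

Lemma image_closed (G K : groupType) (f : {multiplicative G -> K})
    (D : groupClosed G) :
  group_closed (fun y => `[< exists2 x, x \in D & f x = y >]).
Proof.
split=> [|_ _ /asboolP[x xD <-] /asboolP[y yD <-]]; apply/asboolP.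
  by exists 1; rewrite ?gpred1 ?hom1.
by exists (x * y^-1); rewrite ?gpredF ?homF.
Qed.

Definition hom_closed_image (G K : groupType) (f : {multiplicative G -> K})
    (D : groupClosed G) : groupClosed K :=
  closed_of (image_closed f D).

Lemma hom_closed_imageP (G K : groupType) (f : {multiplicative G -> K})
    (D : groupClosed G) y :
  reflect (exists2 x, x \in D & f x = y) (y \in hom_closed_image f D).
Proof. exact: asboolP. Qed.

Lemma inter_closed (G : groupType) (C D : groupClosed G) :
  group_closed (fun x => (x \in C) && (x \in D)).
Proof.
split=> [|x y /andP[xC xD] /andP[yC yD]]; rewrite unfold_in ?gpred1 //.
by rewrite !gpredF.
Qed.

(** A quotient of an amalgamated product is the amalgamated product of the
    images of the factors if nothing is killed beyond the consequences of the
    relations inside the factors. *)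
Section QuotientAmalgam.
Variables (G : groupType) (A B H : groupClosed G).
Hypothesis amalgG : amalgamated_product A B H.
Variables (L : normalSubgroup G).
Hypothesis L_min : forall M : normalSubgroup G,
  (forall x, (x \in A) || (x \in B) ->
     x \in (L : groupClosed G) -> x \in (M : groupClosed G)) ->
  {subset (L : groupClosed G) <= (M : groupClosed G)}.

Let AL := hom_closed_image (proj L) A.
Let BL := hom_closed_image (proj L) B.

Section ProjFactor.
Variable D : groupClosed G.

Lemma mem_proj_factor (x : subgroup_type D) :
  proj L (val x) \in hom_closed_image (proj L) D.
Proof. by apply/hom_closed_imageP; exists (val x) => //; exact: valP. Qed.

Definition proj_factor_fun (x : subgroup_type D) :
    subgroup_type (hom_closed_image (proj L) D) :=
  Sub (proj L (val x)) (mem_proj_factor x).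

Lemma proj_factorM : {morph proj_factor_fun : x y / x * y}.
Proof. by move=> x y; apply: val_inj; rewrite /= projM. Qed.

Definition proj_factor :
    {multiplicative subgroup_type D ->
       subgroup_type (hom_closed_image (proj L) D)} :=
  hom_of proj_factorM.

Lemma val_proj_factor x : val (proj_factor x) = proj L (val x).
Proof. by []. Qed.

End ProjFactor.

Lemma amalgamated_quotient :
  amalgamated_product AL BL (closed_of (inter_closed AL BL)).
Proof.
split=> // K f g fg.
have [|phi [phiA phiB] uniq] :=
    amalgG.2 K (f \o proj_factor A) (g \o proj_factor B).
  move=> a b eqab aH /=.
  have e : val (proj_factor A a) = val (proj_factor B b).
    by rewrite !val_proj_factor eqab.
  apply: fg => //; apply/andP.
  by split; [exact: valP | rewrite e; exact: valP].
have phiL x : x \in (L : groupClosed G) -> phi x = 1.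
  move=> xL; apply/kernelP; apply: L_min xL.
  move=> {}x /orP[xC|xC] /proj_eq1 xL; apply/kernelP.
    rewrite -[x]/(val (Sub x xC : subgroup_type A)) phiA /= -[RHS](hom1 f).
    by congr (f _); apply: val_inj.
  rewrite -[x]/(val (Sub x xC : subgroup_type B)) phiB /= -[RHS](hom1 g).
  by congr (g _); apply: val_inj.
exists (quotient_lift phiL) => [|psi psiA psiB].
  split=> c; have /hom_closed_imageP[x xC ex] := valP c;
    rewrite -ex quotient_liftE.
    rewrite -[x]/(val (Sub x xC : subgroup_type A)) phiA /=.
    by congr (f _); apply: val_inj.
  rewrite -[x]/(val (Sub x xC : subgroup_type B)) phiB /=.
  by congr (g _); apply: val_inj.
elim/coset_projW=> x; rewrite -[coset_proj L x]/(proj L x) quotient_liftE.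
suff : psi \o proj L =1 phi by exact.
apply: uniq => c /=.
  by rewrite -psiA val_proj_factor.
by rewrite -psiB val_proj_factor.
Qed.

End QuotientAmalgam.

Section FactorKernel.
Variables (G : groupType) (A B H : groupClosed G).
Hypothesis amalgG : amalgamated_product A B H.
Variables (Q : finGroupType) (nu : {multiplicative G -> Q}).
Hypothesis nu_surj : surjective nu.

(** The normal closure of the elements of the two factors killed by [nu],
    as an intersection of normal subgroups. *)
Definition factor_kernel_pred : {pred G} := fun x =>
  `[< forall M : normalSubgroup G,
  (forall y, (y \in A) || (y \in B) -> nu y = 1 -> y \in (M : groupClosed G)) ->
  x \in (M : groupClosed G) >].

Lemma factor_kernel_closed : group_closed factor_kernel_pred.
Proof.
split=> [|x y /asboolP Lx /asboolP Ly]; apply/asboolP=> M subM.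
  exact: gpred1.
by rewrite gpredF ?Lx ?Ly.
Qed.

Lemma factor_kernelJ x y :
  x \in closed_of factor_kernel_closed ->
  x ^ y \in closed_of factor_kernel_closed.
Proof.
by move=> /asboolP Lx; apply/asboolP=> M subM; apply: nsubgroupJ; exact: Lx.
Qed.

Definition factor_kernel : normalSubgroup G := NormalSubgroup factor_kernelJ.

Lemma factor_kernelP x : reflect (forall M : normalSubgroup G,
  (forall y, (y \in A) || (y \in B) -> nu y = 1 -> y \in (M : groupClosed G)) ->
  x \in (M : groupClosed G)) (x \in (factor_kernel : groupClosed G)).
Proof. exact: asboolP. Qed.

Lemma factor_kernel_sub x : x \in (factor_kernel : groupClosed G) -> nu x = 1.
Proof.
move=> /factor_kernelP Lx; apply/kernelP.
by apply: Lx => y _ nuy; exact/kernelP.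
Qed.

Lemma factor_kernel_free (P : nat_pred) : nil_pgroup P Q ->
  extension is_free (FN P) (quotient_type factor_kernel).
Proof.
move=> nQ; pose mu := quotient_lift factor_kernel_sub.
have muE x : mu (proj factor_kernel x) = nu x by exact: quotient_liftE.
exists (kernel mu); split; last exact: FN_embed (kernel_lift_inj (f := mu)) nQ.
have L_min (M : normalSubgroup G) :
    (forall x, (x \in A) || (x \in B) ->
       x \in (factor_kernel : groupClosed G) -> x \in (M : groupClosed G)) ->
    {subset (factor_kernel : groupClosed G) <= (M : groupClosed G)}.
  move=> subM x /factor_kernelP; apply=> y yAB nuy; apply: subM => //.
  by apply/factor_kernelP=> M'; apply.
apply: (free_kernel (amalgamated_quotient amalgG L_min)).
- by move=> q; have [x <-] := nu_surj q; exists (proj factor_kernel x).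
- move=> _ /hom_closed_imageP[x xA <-]; rewrite muE => nux; apply/proj_eq1.
  by apply/factor_kernelP=> M; apply=> //; rewrite xA.
- move=> _ /hom_closed_imageP[x xB <-]; rewrite muE => nux; apply/proj_eq1.
  by apply/factor_kernelP=> M; apply=> //; rewrite xB orbT.
Qed.

End FactorKernel.

(** * Residual properties *)

Lemma FN_quotient (P : nat_pred) (G : groupType) (W : finGroupType)
    (Phi : {multiplicative G -> W}) x : nil_pgroup P W -> Phi x != 1 ->
  exists (Q : groupType) (f : {multiplicative G -> Q}),
    [/\ surjective f, FN P Q & f x != 1].
Proof.
move=> nW Phix; exists (quotient_type (kernel Phi)), (proj (kernel Phi)).
split; [exact: proj_surj | exact: FN_embed (kernel_lift_inj (f := Phi)) nW |].
by apply: contra_neq Phix => /proj_eq1/kernelP.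
Qed.

(** The kernel of the projection of the image of [Phi] to [Q] lies in the base
    group, whose exponent divides the order of [K]. *)
Lemma wreath_extension (p : nat) (P : nat_pred) (G : groupType)
    (K Q : finGroupType) (nu : {multiplicative G -> Q})
    (Phi : {multiplicative G -> wreath K Q}) :
  (forall x, (Phi x).2 = nu x) -> p.-group [set: K] -> nil_pgroup P Q ->
  extension (Fp p) (FN P) (quotient_type (kernel Phi)).
Proof.
move=> Phi2 pK nQ.
have ker_sub x : x \in (kernel Phi : groupClosed G) -> nu x = 1.
  by move/kernelP=> Phix; rewrite -Phi2 Phix.
pose Psi := quotient_lift (fun x => elimT (kernelP Phi x)).
have Psi_inj : injective Psi by exact: kernel_lift_inj.
pose mu := quotient_lift ker_sub.
have Psi2 y : (Psi y).2 = mu y.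
  by elim/coset_projW: y => x; rewrite !(quotient_liftE _ x) Phi2.
exists (kernel mu); split; last exact: FN_embed (kernel_lift_inj (f := mu)) nQ.
pose f : {multiplicative subgroup_type (kernel mu) -> wreath K Q} := Psi \o val.
have f_inj : injective f by move=> x y /Psi_inj/val_inj.
apply: (Fp_embed f_inj) => z; exists #[f z].
  by apply/(has_order_inj f_inj); exact: order_has_order.
have fz2 : (f z).2 = 1 by rewrite Psi2; apply/kernelP; exact: valP.
apply: pnat_dvd pK; rewrite order_dvdn wreath_base_exp //; apply/eqP.
by rewrite wreath1; congr pair; apply/ffunP=> u; rewrite !ffunE expg_cardG ?inE.
Qed.

(** Separation inside the factor [A] by finite nilpotent groups becomes
    separation by a homomorphism defined on the whole of [G]. *)
Lemma factor_detection (G : groupType) (A B H : groupClosed G) (P : nat_pred)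
    (D : groupClosed (subgroup_type A)) (a : subgroup_type A) :
  amalgamated_product A B H -> is_separable (FN P) D ->
  (forall p, p \in P -> quasi_regular (Fp p) H) -> a \notin D ->
  exists2 p, p \in P &
    exists (W : finGroupType) (Phi : {multiplicative G -> W}),
    p.-group [set: W] /\ forall d, d \in D -> Phi (val a) <> Phi (val d).
Proof.
move=> amalgG sepD qregH aD.
have [p Pp [E [f [pE fa]]]] := FN_separation sepD aD.
have [W [Phi [pW Phif]]] := quasi_regular_factor amalgG f (qregH p Pp) pE.
exists p => //; exists W, Phi; split=> // d dD Phiad; apply: (fa d dD).
apply: divg1_eq; rewrite -homF; apply: Phif.
by rewrite valM homV homF Phiad mulgV.
Qed.

Lemma subset_in_closed (G : groupType) (H C : groupClosed G) :
  group_closed (subset_in H C).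
Proof.
split=> [|x y]; first exact: (gpred1 (s := H)).
by move=> xH yH; exact: (gpredF (S := H)) xH yH.
Qed.

Section Separation.
Variables (G : groupType) (A B H : groupClosed G) (P : nat_pred).
Hypotheses (amalgG : amalgamated_product A B H)
  (sepHA : is_separable (FN P) (subset_in H A))
  (sepHB : is_separable (FN P) (subset_in H B))
  (qregH : forall p, p \in P -> quasi_regular (Fp p) H).

(** The common source of the residual properties.  The last condition
    says that [Phi] factors through the quotient by [factor_kernel A B nu]. *)
Definition wreath_detected (x : G) : Prop :=
  exists (Q : finGroupType) (nu : {multiplicative G -> Q}),
    [/\ nil_pgroup P Q, surjective nu & forall p, prime p ->
      exists (K : finGroupType) (Phi : {multiplicative G -> wreath K Q}),
      [/\ p.-group [set: K], Phi x != 1, forall y, (Phi y).2 = nu y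
        & forall y, (y \in A) || (y \in B) -> nu y = 1 -> Phi y = 1]].

Lemma syllable_detection x : (x \in A) || (x \in B) -> x \notin H ->
  exists (Q : finGroupType) (nu : {multiplicative G -> Q}),
    nil_pgroup P Q /\ forall h, h \in H -> nu x <> nu h.
Proof.
move=> /orP[xA|xB] xH.
  have [p Pp [W [Phi [pW Phix]]]] :=
    factor_detection (D := closed_of (subset_in_closed H A)) (a := Sub x xA)
      amalgG sepHA qregH xH.
  exists W, Phi; split; first exact: pgroup_nil_pgroup pW.
  by move=> h hH; apply: (Phix (Sub h (sub_HA amalgG hH))).
have [p Pp [W [Phi [pW Phix]]]] :=
  factor_detection (D := closed_of (subset_in_closed H B)) (a := Sub x xB)
    (amalgamated_sym amalgG) sepHB qregH xH.
exists W, Phi; split; first exact: pgroup_nil_pgroup pW.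
by move=> h hH; apply: (Phix (Sub h (sub_HB amalgG hH))).
Qed.

Lemma syllables_detection (l : seq G) :
  (forall x, x \in l -> ((x \in A) || (x \in B)) && (x \notin H)) ->
  exists (Q : finGroupType) (nu : {multiplicative G -> Q}),
    [/\ nil_pgroup P Q, surjective nu &
        forall x h, x \in l -> h \in H -> nu x <> nu h].
Proof.
move=> lAB.
suff [Q [nu [nQ sep]]] :
    exists (Q : finGroupType) (nu : {multiplicative G -> Q}),
    nil_pgroup P Q /\ forall x h, x \in l -> h \in H -> nu x <> nu h.
  exists (subg_of (hom_image_group nu)), (corestr nu); split.
  - exact: nil_pgroup_corestr.
  - exact: corestr_surj.
  - move=> x h xl hH e; apply: (sep x h xl hH).
    by rewrite -!(sgval_corestr nu) e.
elim: l lAB => [|x l IHl] lAB.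
  have [F nF] := trivial_nil_pgroup P.
  have oneM : {morph (fun _ : G => 1 : F) : x y / x * y}.
    by move=> x y; rewrite mulg1.
  by exists F, (hom_of oneM).
have [|Q [nu [nQ sep]]] := IHl.
  by move=> y yl; apply: lAB; rewrite in_cons yl orbT.
have /andP[xAB xH] := lAB x (mem_head _ _).
have [Q' [nu' [nQ' sep']]] := syllable_detection xAB xH.
have pairM : {morph (fun y => (nu y, nu' y) : (Q * Q')%type) : y z / y * z}.
  by move=> y z; rewrite !gmulfM.
exists (Q * Q')%type, (hom_of pairM); split; first exact: nil_pgroup_prod.
move=> y h; rewrite in_cons => /orP[/eqP->|yl] hH [e e']; first exact: sep' e'.
exact: (sep y h yl hH).
Qed.

Lemma outside_detection x : x \notin B -> wreath_detected x.
Proof.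
move=> xB; have [b [s [bB rs defx]]] := reduced_word_exists amalgG x.
have s_neq0 : s != [::].
  by apply: contraNneq xB => s0; rewrite defx s0 /word_value mulg1.
pose l := [seq z <- [seq ab.1 | ab <- s] ++ [seq ab.2 | ab <- s] | z \notin H].
have rsAB ab : ab \in s -> (ab.1 \in A) && (ab.2 \in B).
  elim: (s) rs => [|[a c] s' IHs] //= /and5P[aA _ cB _ rs'].
  rewrite in_cons => /orP[/eqP->|abs]; [by rewrite /= aA | exact: IHs].
have [|Q [nu [nQ nu_surj sep]]] := syllables_detection (l := l).
  move=> z; rewrite mem_filter mem_cat.
  move=> /andP[-> /orP[]] /mapP[ab /rsAB/andP[abA abB] ->].
    by rewrite abA.
  by rewrite abB orbT.
exists Q, nu; split=> // p p_pr.
have sepw : separates_word H nu s.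
  move=> a c acs; split=> zH; apply/hom_imageP=> -[h /= /esym];
    apply: sep (valP h); rewrite mem_filter zH mem_cat; apply/orP.
    by left; apply/mapP; exists (a, c).
  by right; apply/mapP; exists (a, c).
have [K [Phi [pK Phix Phi2 PhiAB]]] :=
  word_detection amalgG p_pr bB rs s_neq0 sepw.
by exists K, Phi; split=> //; rewrite defx.
Qed.

(** Here no word is involved: a finite [p]-quotient of [B] which detects [x] is
    controlled by a finite [p]-quotient of [G]. *)
Lemma inside_detection x : is_separable (FN P) (pred1 (1 : subgroup_type B)) ->
  x \in B -> x != 1 ->
  exists (Q : finGroupType) (nu : {multiplicative G -> Q}),
    [/\ nil_pgroup P Q, surjective nu & nu x != 1].
Proof.
move=> sep1B xB x_neq1.
have one_closed : group_closed (pred1 (1 : subgroup_type B)).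
  by split=> [|y z]; rewrite !inE // => /eqP-> /eqP->; rewrite mulgV.
have [|p Pp [W [Phi [pW Phix]]]] :=
    factor_detection (D := closed_of one_closed) (a := Sub x xB)
      (amalgamated_sym amalgG) sep1B qregH.
  by rewrite inE -val_eqE.
exists (subg_of (hom_image_group Phi)), (corestr Phi); split.
- exact: nil_pgroup_corestr (pgroup_nil_pgroup Pp pW).
- exact: corestr_surj.
apply/eqP=> e; apply: (Phix 1); first by rewrite inE.
by rewrite hom1 /= -(sgval_corestr Phi) e.
Qed.

Lemma detection x :
  is_separable (FN P) (pred1 (1 : subgroup_type B)) -> x != 1 ->
  wreath_detected x.
Proof.
move=> sep1B x_neq1.
have [xB|xB] := boolP (x \in B); last exact: outside_detection.
have [Q [nu [nQ nu_surj nux]]] := inside_detection sep1B xB x_neq1.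
exists Q, nu; split=> // p p_pr.
(* As [nu x != 1], the trivial base group suffices. *)
have [K [_ pK]] := trivial_nil_pgroup p.
have PhiM : {morph (fun y => ([ffun=> 1], nu y) : wreath K Q) : y z / y * z}.
  move=> y z; rewrite wreathM gmulfM; congr pair.
  by apply/ffunP=> u; rewrite !ffunE mulg1.
exists K, (hom_of PhiM); split=> //; last by move=> y _ /= ->.
by apply: contra_neq nux => -[].
Qed.

End Separation.

Lemma is_separable_sub (C D : group_class) (G : groupType) (Y : {pred G}) :
  (forall Q, C Q -> D Q) -> is_separable C Y -> is_separable D Y.
Proof.
move=> CD sepY x /sepY[Q [f [f_surj /CD DQ fx]]].
by exists Q, f.
Qed.

Lemma Fp_FN (p : nat) (Q : groupType) : Fp p Q -> FN p Q.
Proof.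
case/Fp_inv=> F [f [f_inj pF]].
by apply: FN_embed f_inj (pgroup_nil_pgroup _ pF); exact: eqxx.
Qed.

Theorem theorem7 (G : groupType) (A B H : groupClosed G) (P : nat_pred)
    (amalgG : amalgamated_product A B H)
    (P_primes : forall p, p \in P -> prime p)
    (P_nonempty : exists p, p \in P)
    (sep1A : is_separable (FN P) (pred1 (1 : subgroup_type A)))
    (sep1B : is_separable (FN P) (pred1 (1 : subgroup_type B)))
    (sepHA : is_separable (FN P) (subset_in H A))
    (sepHB : is_separable (FN P) (subset_in H B))
    (qregH : forall p, p \in P -> quasi_regular (Fp p) H) :
  (residually (extension is_free (FN P)) G /\
   forall p, prime p -> residually (extension (Fp p) (FN P)) G)
  /\
  ((exists q, [/\ q \in P,
      group_closed (coprime_roots q (subgroup_type H)),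
      is_separable (Fp q) (coprime_roots q (subgroup_type H)),
      is_separable (Fp q) (subset_in H A) &
      is_separable (Fp q) (subset_in H B)]) ->
   residually (FN P) G).
Proof.
split; first split=> [x x_neq1|p p_pr x x_neq1].
- have [Q [nu [nQ nu_surj detect]]] :=
    detection amalgG sepHA sepHB qregH sep1B x_neq1.
  have [K [Phi [_ Phix _ PhiAB]]] := detect 2 isT.
  exists (quotient_type (factor_kernel A B nu)), (proj (factor_kernel A B nu)).
  split; [exact: proj_surj | exact: (factor_kernel_free amalgG) |].
  apply: contra_neq Phix => /proj_eq1/factor_kernelP Lx.
  apply/kernelP; apply: Lx => y yAB nuy; apply/kernelP; exact: PhiAB.
- have [Q [nu [nQ _ detect]]] :=
    detection amalgG sepHA sepHB qregH sep1B x_neq1.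
  have [K [Phi [pK Phix Phi2 _]]] := detect p p_pr.
  exists (quotient_type (kernel Phi)), (proj (kernel Phi)).
  split; [exact: proj_surj | exact: (wreath_extension Phi2) |].
  by apply: contra_neq Phix => /proj_eq1/kernelP.
- case=> q [Pq _ _ qsepA qsepB] x x_neq1.
  have {}qsepA := is_separable_sub (@Fp_FN q) qsepA.
  have {}qsepB := is_separable_sub (@Fp_FN q) qsepB.
  have [xB|xB] := boolP (x \in B).
    have [Q [nu [nQ _ nux]]] := inside_detection amalgG qregH sep1B xB x_neq1.
    exact: FN_quotient nQ nux.
  have [|Q [nu [[_ qQ] _ detect]]] := outside_detection amalgG qsepA qsepB _ xB.
    by move=> p /eqP->; exact: qregH.
  have [K [Phi [qK Phix _ _]]] := detect q (P_primes q Pq).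
  exact: FN_quotient (pgroup_nil_pgroup Pq (pgroup_wreath qK qQ)) Phix.
Qed.
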